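(* There do not exist a strictly increasing sequence of stopping times $\{\lambda_n\}$ and estimators $\{h_n(X_0,\dots,X_{\lambda_n})\}$ taking the values one and two such that for all stationary and ergodic countable alphabet Markov chains $\{X_n\}$ of order two both $$\lim_{n\to\infty}\frac{\lambda_n}{n}=1\quad\text{with probability one}$$ and $$\lim_{n\to\infty}\left|h_n(X_0,\dots,X_{\lambda_n})-K(X_{-\infty}^{\lambda_n})\right|=0\quad\text{with probability one.}$$
   Context: Alphabet: the countable alphabet may be taken to be the nonnegative integers. The stopping times and the estimators are universal, i.e. they are fixed functions of the observed sequence $X_0,X_1,X_2,\dots$ not depending on the distribution of the process: the event $\{\lambda_n=m\}$ is determined by $(X_0,\dots,X_m)$, and $h_n$ is a function of $(X_0,\dots,X_{\lambda_n})$. A Markov chain of order two is a process for which the conditional distribution of $X_{n+1}$ given $X_{-\infty}^n$ depends only on $(X_{n-1},X_n)$ and for which two is the least such order. Memory length: write $X_m^n=(X_m,\dots,X_n)$ (empty string if $m>n$), $p(\cdot)$ for the probability of a finite string, and $p(y|x_{-k}^0)=P(X_1=y\mid X_{-k}^0=x_{-k}^0)$ (with $p(y|\emptyset)=P(X_1=y)$). $K(X_{-\infty}^0)$ is the smallest $0\le K<\infty$ such that for all $i\ge1$, all letters $y$ and all strings $z_{-K-i+1}^{-K}$ of length $i$, $p(y|X_{-K+1}^0)=p(y|z_{-K-i+1}^{-K},X_{-K+1}^0)$ provided $p(z_{-K-i+1}^{-K},X_{-K+1}^0,y)>0$. $K(X_{-\infty}^m)$ is the same function applied to the past of time $m$ (i.e.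 to the shifted sequence). *)

(* Defs.v *)
From HB Require Import structures.
From mathcomp Require Import all_boot all_order all_algebra.
From mathcomp Require Import all_classical all_reals all_analysis.

Set Implicit Arguments.
Unset Strict Implicit.
Unset Printing Implicit Defensive.

Import Order.TTheory GRing.Theory Num.Theory.
Import numFieldNormedType.Exports.

Local Open Scope classical_set_scope.
Local Open Scope ring_scope.

(* The countable alphabet is nat; processes are
   two-sided, indexed by int.  Finite strings are sequences of letters listed
   in increasing order of time. *)

(* The string x_(m-k+1), ..., x_m; empty for k = 0. *)
Definition suffix_at (x : int -> nat) (m : int) (k : nat) : seq nat :=
  mkseq (fun i : nat => x (m - k%:Z + 1 + i%:Z)) k.

Definition shift_seq (x : int -> nat) : int -> nat := fun n => x (n + 1).

(* Generators of the product sigma-algebra on two-sided sequences. *)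
Definition coordinate_sets : set (set (int -> nat)) :=
  [set B | exists (i : int) (a : nat), B = [set x | x i = a]].

Section Process.
Context {R : realType} {d : measure_display} {T : measurableType d}.
Variables (P : probability T R) (X : int -> {RV P >-> nat}).

Definition path_of (t : T) : int -> nat := fun i => X i t.

(* The event that the string s is read from time m on. *)
Definition string_event (m : int) (s : seq nat) : set T :=
  [set t | forall i : nat, (i < size s)%N -> X (m + i%:Z) t = nth 0%N s i].

Definition stationary : Prop :=
  forall (m : int) (s : seq nat), P (string_event m s) = P (string_event 0 s).

Definition ergodic : Prop :=
  forall B : set (int -> nat),
    <<s coordinate_sets >> B -> shift_seq @^-1` B = B ->
    P (path_of @^-1` B) = 0%E \/ P (path_of @^-1` B) = 1%E.

(* The sigma-algebra of X_i, i <= n. *)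
Definition past_sigma (n : int) : set (set T) :=
  <<s [set B | exists (i : int) (a : nat), i <= n /\ B = X i @^-1` [set a]] >>.

(* The conditional probability of X_(n+1) = y given the infinite past of time
   n has a version which is a function q of the last k letters; such a version
   is automatically measurable for the past, since strings are countably
   many. *)
Definition depends_on_last (k : nat) : Prop :=
  forall (n : int) (y : nat), exists q : seq nat -> R,
    forall A : set T, past_sigma n A ->
      P (A `&` X (n + 1) @^-1` [set y]) =
      (\int[P]_(t in A) (q (suffix_at (path_of t) n k))%:E)%E.

Definition markov_of_order (k : nat) : Prop :=
  depends_on_last k /\ forall j : nat, (j < k)%N -> ~ depends_on_last j.

(* The probability that the string s is read at the times up to and including
   e. *)
Definition prob_ending (e : int) (s : seq nat) : R :=
  fine (P (string_event (e - (size s)%:Z + 1) s)).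

(* p(y | s): the probability of X_1 = y given that s is read up to time 0;
   the value is 0 when s has probability 0. *)
Definition cond_prob (y : nat) (s : seq nat) : R :=
  prob_ending 1 (rcons s y) / prob_ending 0 s.

Definition memory_suffices (s : seq nat) : Prop :=
  forall (z : seq nat) (y : nat), (0 < size z)%N ->
    0 < prob_ending 1 (rcons (z ++ s) y) ->
    cond_prob y s = cond_prob y (z ++ s).

(* The memory length of the past of x at time m, i.e. the least k that
   suffices; it is +oo if there is none. *)
Definition memory_length (x : int -> nat) (m : int) : \bar R :=
  ereal_inf [set (k%:R)%:E | k in
    [set k : nat | memory_suffices (suffix_at x m k)]].

End Process.

(* Stopping times are functions of the one-sided sequence of observations,
   with None for the value infinity. *)
Definition is_stopping_time (tau : (nat -> nat) -> option nat) : Prop :=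
  forall (x x' : nat -> nat) (m : nat),
    (forall i, (i <= m)%N -> x i = x' i) -> tau x = Some m -> tau x' = Some m.

(* Strict inequality is only required where the later time is finite, and
   then the earlier one has to be finite too. *)
Definition strictly_increasing (lam : nat -> (nat -> nat) -> option nat) :
    Prop :=
  forall (n : nat) (x : nat -> nat) (m : nat),
    lam n.+1 x = Some m -> exists2 k : nat, lam n x = Some k & (k < m)%N.

Definition time_ratio (R : realType) (lam : nat -> (nat -> nat) -> option nat)
    (x : nat -> nat) (n : nat) : \bar R :=
  if lam n x is Some m then (m%:R / n%:R)%:E else +oo%E.

Section Estimation.
Context {R : realType} {d : measure_display} {T : measurableType d}.
Variables (P : probability T R) (X : int -> {RV P >-> nat}).
Variables (lam : nat -> (nat -> nat) -> option nat) (h : nat -> seq nat -> nat).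

Definition observed (t : T) : nat -> nat := fun i => X i%:Z t.

(* |h_n(X_0, ..., X_(lam_n)) - K(X_(-oo)^(lam_n))|.  The value +oo given for an
   infinite stopping time plays no role once lam_n / n converges to 1, since
   lam_n is then finite for all large n. *)
Definition estimation_error (t : T) (n : nat) : \bar R :=
  if lam n (observed t) is Some m then
    `| ((h n (mkseq (observed t) m.+1))%:R)%:E
       - memory_length X (path_of X t) m%:Z |%E
  else +oo%E.

End Estimation.

(* Main.v *)
Require Import Defs.
From HB Require Import structures.
From mathcomp Require Import all_boot all_order all_algebra.
From mathcomp Require Import all_classical all_reals all_analysis.
From mathcomp Require Import zify lra.

(** Whether the current letter [k] alone determines the law of the next one can
depend on what happens after a single pair [(u, k)].  If [u] is rare enough, a
chain in which this pair matters cannot be told, for a very long time, from one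
in which it does not, and on an infinite alphabet this ambiguity can be renewed
for one letter after the other.

All chains used are codings of one two-sided iid sequence [w] of letters with
geometric law.  A function [c] gives each letter [v >= 2] a partner [c v], a
value below 2 meaning that there is none, and [marked c w] is [w] with each 0
that comes just after a pattern [(c v, v)] turned into a 1.  As 0 and 1 belong
to no pattern, [w] and [marked c w] have the same patterns; so [marked c w] is a
Markov chain, of order exactly two as soon as one pattern exists
([markov_process]), and it inherits stationarity and ergodicity from [w].  A
letter [v >= 2] has memory length at most one without a partner
([memory_suffices_letter]) and at least two with one
([not_memory_suffices_nil], [not_memory_suffices_letter]).

Suppose now that [lam] and [h] succeed on all these chains.  If [k] has no
partner, then [h] finally answers 1 whenever [lam n] falls on the letter [k],
and this happens again and again: [lam n / n --> 1] leaves out a set of times of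
density zero, whereas the visits to [k] on an event of positive probability
cannot have density zero, because the iid sequence is mixing ([tame_null]).
Hence for some [N] it has probability more than 3/4 that the answer 1 is given
on the letter [k] at a time between [k] and [N] ([trapped]).  This event
involves the times up to [N] only.  Give [k] a partner so rare that with
probability more than 3/4 no letter as large is met in that period, give the
letters beyond [k] partners that are at least as large, and repeat this for
[k = 3, 4, 5, ...].  In the resulting chain each letter [k >= 2] has memory
length at least two; but for each [k >= 3] the answer 1 is given on the letter
[k] at time [k] or later with probability at least 1/2
([wrong_after_choice]).  So with probability at least 1/2 the estimator errs
infinitely often.

The iid sequence is obtained by pushing Lebesgue measure on ]0, 1] forward along
a digit expansion ([iid_measure_cylinder]); independence of past and future and
mixing follow from the case of cylinders by one and the same pi-lambda argument
([product_limit]). *)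

Set Implicit Arguments.
Unset Strict Implicit.
Unset Printing Implicit Defensive.

Import Order.TTheory GRing.Theory Num.Theory.
Import numFieldNormedType.Exports.

Local Open Scope classical_set_scope.
Local Open Scope ring_scope.

(** * An iid sequence of geometric letters *)

Section DigitCoding.
Variable R : realType.
Implicit Types (u v : R) (a b n : nat) (s : seq nat).

Definition geom a : R := (2 ^ a.+1)%:R^-1.

Lemma geom_gt0 a : 0 < geom a.
Proof. by rewrite invr_gt0 ltr0n expn_gt0. Qed.

Lemma geomS a : geom a = 2 * geom a.+1.
Proof.
rewrite /geom [(2 ^ a.+2)%N]expnS natrM invfM mulrA divff ?mul1r//.
Qed.

Lemma geom_le a b : (a <= b)%N -> geom b <= geom a.
Proof.
move=> ab; rewrite lef_pV2 ?posrE ?ltr0n ?expn_gt0//.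
by rewrite ler_nat leq_exp2l.
Qed.

Lemma geom_half a : 2 * geom a <= 1.
Proof.
rewrite /geom expnS natrM invfM mulrA divff ?mul1r//.
by rewrite invf_le1 ?ltr0n ?expn_gt0// ler1n expn_gt0.
Qed.

Lemma geom_small u : 0 < u -> exists a, geom a < u.
Proof.
move=> u0; exists (Num.truncn u^-1).
rewrite /geom invf_plt ?posrE ?ltr0n ?expn_gt0//.
apply: (lt_le_trans (truncnS_gt _)).
by rewrite ler_nat ltnW// (leq_ltn_trans _ (ltn_expl _ _)).
Qed.

(** The branches ]geom a, 2 * geom a] tile ]0, 1]; the default value is met
outside ]0, 1] only. *)
Definition digit u : nat := xget 0%N [set a | geom a < u <= 2 * geom a].
(** The affine bijection from the branch of [u] onto ]0, 1]. *)
Definition rescale u : R := u / geom (digit u) - 1.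
Definition digits u n : nat := digit (iter n rescale u).

Lemma digit_eq u a : geom a < u <= 2 * geom a -> digit u = a.
Proof.
move=> ua; rewrite /digit; case: xgetP => [b _ /= ub|/(_ a)//].
by apply/eqP; rewrite eqn_leq; apply/andP; split; rewrite leqNgt; apply/negP;
  move=> /geom_le; rewrite -(ler_pM2l (ltr0n R 2)) -geomS;
  [case/andP: ub; case/andP: ua|case/andP: ua; case/andP: ub] => *; lra.
Qed.

Lemma digit_bounds u : 0 < u <= 1 -> geom (digit u) < u <= 2 * geom (digit u).
Proof.
move=> /andP[u0 u1]; have [m geomm minm] := ex_minnP (geom_small u0).
suff um : geom m < u <= 2 * geom m by rewrite (digit_eq um).
rewrite geomm /=; case: m geomm minm => [|m] geomm minm.
  by rewrite /geom expn1 divff.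
by rewrite -geomS leNgt; apply/negP => /minm; rewrite ltnn.
Qed.

Lemma rescale_itv u : 0 < u <= 1 -> 0 < rescale u <= 1.
Proof.
move=> /digit_bounds /andP[]; rewrite /rescale.
have g0 := geom_gt0 (digit u).
by rewrite subr_gt0 lerBlDr ltr_pdivlMr// mul1r ler_pdivrMr// => -> ->.
Qed.

(** The points whose expansion starts with [s] form an interval; its left end is
the image of 0 under the inverse branches [v |-> (v + 1) * geom a], [a] in [s].
*)
Fixpoint left_end s : R :=
  if s is a :: s' then (left_end s' + 1) * geom a else 0.

Definition weight s : R := \prod_(a <- s) geom a.

Lemma weight_cons a s : weight (a :: s) = geom a * weight s.
Proof. by rewrite /weight big_cons. Qed.

Lemma weight_ge0 s : 0 <= weight s.
Proof. by apply: prodr_ge0 => a _; exact/ltW/geom_gt0. Qed.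

Lemma left_end_itv s : 0 <= left_end s /\ left_end s + weight s <= 1.
Proof.
elim: s => [|a s [ge0 le1]] /=; first by rewrite /weight big_nil add0r.
have g0 := geom_gt0 a; have g1 := geom_half a.
split; first by rewrite mulr_ge0 ?ltW// ltr_wpDl.
rewrite weight_cons mulrC -mulrDr; apply: le_trans g1.
by rewrite [leRHS]mulrC ler_pM2l//; lra.
Qed.

(** An expansion starts with [a :: s] when [u] is in the branch of [a], which
[rescale] expands by [(geom a)^-1], and the rescaled point starts with [s]. *)
Lemma digits_prefix u s : 0 < u <= 1 ->
  (forall i, (i < size s)%N -> digits u i = nth 0%N s i) <->
  left_end s < u <= left_end s + weight s.
Proof.
elim: s u => [|a s IH] u u01; first by rewrite /weight big_nil /= add0r.
have g0 := geom_gt0 a; have [le0 le1] := left_end_itv s.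
have bounds : digit u = a -> left_end s < rescale u <= left_end s + weight s
    <-> left_end (a :: s) < u <= left_end (a :: s) + weight (a :: s).
  move=> ua; rewrite /rescale ua /= weight_cons [geom a * _]mulrC -mulrDl.
  rewrite ltrBrDr ltr_pdivlMr// lerBlDr ler_pdivrMr//.
  by rewrite addrAC.
split=> [us|].
  have ua : digit u = a by exact: (us 0%N).
  apply/bounds => //; apply/IH => [|i si]; first exact: rescale_itv.
  by have := us i.+1 si; rewrite /digits iterSr.
move=> us; have ua : digit u = a.
  apply: digit_eq; move: us; rewrite /= weight_cons => /andP[us1 us2].
  have lo := mulr_ge0 le0 (ltW g0).
  have hi : 0 <= (1 - (left_end s + weight s)) * geom a.
    by rewrite mulr_ge0 ?(ltW g0)// subr_ge0.
  by apply/andP; split; lra.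
have /IH ih : 0 < rescale u <= 1 by exact: rescale_itv.
move: us => /bounds -/(_ ua) /ih us [|i] // si.
by rewrite /digits iterSr; exact: us.
Qed.

Lemma digits_prefix_itv s :
  [set u | 0 < u <= 1 /\ forall i, (i < size s)%N -> digits u i = nth 0%N s i] =
  [set` `]left_end s, left_end s + weight s]].
Proof.
have [le0 le1] := left_end_itv s.
apply/seteqP; split=> u /=; rewrite in_itv/=.
  by move=> [u01 /digits_prefix]; apply.
move=> us; have u01 : 0 < u <= 1.
  by move: us => /andP[us1 us2]; rewrite (le_lt_trans le0)//= (le_trans us2).
by split=> //; apply/digits_prefix.
Qed.

Lemma measurable_unit_itv : measurable (`]0, 1] : set R).
Proof. by []. Qed.

Definition unit_law := mrestr (@lebesgue_measure R) measurable_unit_itv.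

HB.instance Definition _ := Measure.on unit_law.

Lemma unit_law_setT : unit_law setT = 1%E.
Proof.
rewrite /unit_law /mrestr setTI lebesgue_measure_itv/= lte_fin ltr01.
by rewrite -EFinB subr0.
Qed.

HB.instance Definition _ :=
  Measure_isProbability.Build _ _ _ unit_law unit_law_setT.

Lemma measurable_digit n a :
  measurable [set u : R | 0 < u <= 1 /\ digits u n = a].
Proof.
(* The earlier digits [s] range over a countable set. *)
rewrite (_ : [set _ | _] = \bigcup_(s : seq nat)
  (if size s == n then [set` `]left_end (rcons s a),
                               left_end (rcons s a) + weight (rcons s a)]]
   else set0)); last first.
  apply/seteqP; split=> u /=.
    move=> [u01 una]; exists (mkseq (digits u) n) => //=.
    rewrite size_mkseq eqxx -digits_prefix_itv/=; split=> // i.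
    rewrite size_rcons size_mkseq ltnS => ni; rewrite nth_rcons size_mkseq.
    case: ltngtP ni => // [ni _|->]; first by rewrite nth_mkseq.
    by rewrite una.
  move=> [s _ /=]; case: eqP => //= sn; rewrite -/([set` _] u).
  rewrite -digits_prefix_itv/= => -[u01 us].
  by split=> //; rewrite us ?size_rcons ?sn// nth_rcons sn ltnn eqxx.
apply: countable_bigcupT_measurable => [|s]; first exact: countableP.
by case: ifP.
Qed.

Lemma measurable_window n (J : pred nat) (a : nat -> nat) :
  measurable [set u : R | 0 < u <= 1 /\
                forall j, (j < n)%N -> J j -> digits u j = a j].
Proof.
rewrite (_ : [set _ | _] = `]0, 1] `&` \bigcap_(j in [set j | (j < n)%N && J j])
    [set u | 0 < u <= 1 /\ digits u j = a j]).
  apply: measurableI => //; apply: bigcap_measurableType => j _.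
  exact: measurable_digit.
apply/seteqP; split=> u /=; rewrite in_itv/=.
  by move=> [u01 us]; split=> // j /= /andP[jn Jj]; split=> //; exact: us.
move=> [u01 us]; split=> // j jn Jj; have /= := us j; rewrite jn Jj.
by move=> /(_ isT)[].
Qed.

Lemma geom_sum (r : R) : (\sum_(a <oo) (geom a * r)%:E)%E = r%:E.
Proof.
apply/cvg_lim => //.
have := @cvg_geometric_eseries_half R r 0; rewrite expr0 divr1.
rewrite (_ : eseries _ =
  (fun n => \sum_(0 <= k < n) (geom k * r)%:E)%E)//.
apply/funext => n; rewrite /eseries /=; apply: eq_bigr => k _.
by rewrite addn1 mulrC.
Qed.

(** If all digits before [n] are prescribed, the set is an interval of the right
length. A position left free is filled with all its possible digits, which
splits the set into pieces whose measures are in geometric proportion. *)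
Lemma window_measure n (J : pred nat) (a : nat -> nat) :
  unit_law [set u : R | 0 < u <= 1 /\ forall j, (j < n)%N -> J j -> digits u j = a j]
  = (\prod_(j < n | J j) geom (a j))%:E.
Proof.
pose E (J : pred nat) (a : nat -> nat) := [set u : R | 0 < u <= 1 /\
  forall j, (j < n)%N -> J j -> digits u j = a j].
rewrite -/(E J a).
suff claim d k : (k + d = n)%N -> forall (J : pred nat) (a : nat -> nat),
    (forall j, (j < k)%N -> J j) ->
    unit_law (E J a) = (\prod_(j < n | J j) geom (a j))%:E.
  by apply: (claim n 0%N).
(* [d] counts the positions that may still be free: all those before [k] are
   prescribed. *)
elim: d k => [|d IH] k; rewrite ?addn0 => kdn {}J {}a Jk.
  rewrite /unit_law /mrestr setIidl; last by move=> u [u01 _]; rewrite /= in_itv.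
  rewrite (_ : E J a = [set` `]left_end (mkseq a n),
      left_end (mkseq a n) + weight (mkseq a n)]]).
    rewrite lebesgue_measure_itv /= lte_fin ltrDl.
    have w : weight (mkseq a n) = \prod_(j < n | J j) geom (a j).
      rewrite /weight big_map -{1}(subn0 n) big_mkord.
      by apply: eq_bigl => j; rewrite Jk// kdn.
    rewrite -EFinB addrAC subrr add0r w; case: ifP => // /negbT.
    by rewrite -leNgt => le0; congr EFin; apply/le_anti; rewrite le0 -w weight_ge0.
  rewrite -digits_prefix_itv size_mkseq; apply/seteqP; split=> u /= [u01 us].
    by split=> // i ni; rewrite nth_mkseq// us// Jk// kdn.
  by split=> // j jn _; rewrite us// nth_mkseq.
have kn : (k < n)%N by lia.
have [Jk'|Jk'] := boolP (J k).
  apply: (IH k.+1); first by lia.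
  by move=> j; rewrite ltnS leq_eqVlt => /orP[/eqP ->//|]; exact: Jk.
pose J' := predU1 k J; pose a' b := fun j => if j == k then b else a j.
rewrite (_ : E J a = \bigcup_b E J' (a' b)); last first.
  apply/seteqP; split=> u /=.
    move=> [u01 us]; exists (digits u k) => //; split=> // j jn.
    rewrite /J' /a' /=; case: eqP => [-> //|_ /=]; exact: us.
  move=> [b _ [u01 us]]; split=> // j jn Jj.
  have := us j jn; rewrite /J' /a' /= Jj orbT => /(_ isT) ->.
  by case: eqP => // jk; move: Jk'; rewrite -jk Jj.
rewrite measure_semi_bigcup //.
- rewrite (eq_eseriesr (g := fun b => (geom b *
      \prod_(j < n | J j) geom (a j))%:E)) ?geom_sum// => b _.
  apply: etrans (IH k.+1 _ _ _ _) _; first by lia.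
    move=> j; rewrite ltnS /J' /= leq_eqVlt => /orP[->//|jk].
    by rewrite Jk ?orbT.
  congr EFin; rewrite (bigD1 (Ordinal kn)) /=; last by rewrite /J' /= eqxx.
  rewrite /a' /= eqxx; congr (_ * _); apply: eq_big => j.
    rewrite /J' /= -val_eqE /=; case: eqP => /= [->|_]; last by rewrite andbT.
    by rewrite (negbTE Jk').
  by case/andP=> _; rewrite -val_eqE /= => /negbTE ->.
- by move=> b; exact: measurable_window.
- apply/trivIsetP => b b' _ _ bb'; apply/seteqP; split=> // u /=.
  move=> [[_ us] [_ us']]; move/eqP: bb'; apply.
  have := us k kn; have := us' k kn.
  by rewrite /J' /a' /= eqxx => /(_ isT) <- /(_ isT) <-.
- by apply: bigcup_measurable => b _; exact: measurable_window.
Qed.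

Lemma uniq_window_measure (J : seq nat) (a : nat -> nat) : uniq J ->
  unit_law [set u : R | 0 < u <= 1 /\ forall j, j \in J -> digits u j = a j]
  = (\prod_(j <- J) geom (a j))%:E.
Proof.
move=> uJ; pose n := (\max_(j <- J) j).+1.
have Jn j : j \in J -> (j < n)%N.
  by move=> jJ; rewrite ltnS; apply: (leq_bigmax_seq (F := id)).
transitivity (\prod_(j < n | (j : nat) \in J) geom (a j))%:E.
  rewrite -window_measure; congr unit_law; apply/seteqP; split=> u /= [u01 us].
    by split=> // j _; exact: us.
  by split=> // j jJ; apply: us => //; exact: Jn.
congr EFin; rewrite -(big_mkord (mem J) (fun j => geom (a j))) -big_filter.
apply: perm_big; apply: uniq_perm => //.
  by rewrite filter_uniq// iota_uniq.
move=> j; rewrite mem_filter mem_index_iota /=.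
by apply: andb_idr => /Jn.
Qed.

Definition path_space := g_sigma_algebraType coordinate_sets.

Definition cylinder (I : seq int) (a : int -> nat) : set path_space :=
  [set w | forall i, i \in I -> w i = a i].

(** Times in [int] are spread over the digits by [pickle], an injection:
distinct times read distinct digits. *)
Definition coding (u : measurableTypeR R) : path_space := fun i : int =>
  if 0 < u <= 1 then digits u (pickle i) else 0%N.

Lemma measurable_coding : measurable_fun setT coding.
Proof.
apply: (@measurability _ _ _ path_space _ _ coordinate_sets) =>
  // _ [B [i [a ->]] <-].
rewrite setTI (_ : _ @^-1` _ =
  [set u | 0 < u <= 1 /\ digits u (pickle i) = a] `|`
  (~` `]0, 1] `&` (if a == 0%N then setT else set0))).
  apply: measurableU; first exact: measurable_digit.
  by apply: measurableI; [apply: measurableC|case: ifP].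
apply/seteqP; split=> u /=; rewrite /coding in_itv/=.
  by case: ifP => [u01 ua|u01 <-]; [left|right].
move=> [[-> ->] //|[/negP/negbTE ->]].
by case: (a =P 0%N) => [->|].
Qed.

HB.instance Definition _ := isMeasurableFun.Build _ _ _ _ coding measurable_coding.

Definition iid_measure : probability path_space R :=
  distribution unit_law coding.

Lemma iid_measure_cylinder (I : seq int) (a : int -> nat) : uniq I ->
  iid_measure (cylinder I a) =
  (\prod_(i <- I) geom (a i))%:E.
Proof.
move=> uI; pose a' j := if unpickle j is Some i then a i else 0%N.
transitivity (\prod_(j <- map pickle I) geom (a' j))%:E; last first.
  by congr EFin; rewrite big_map; apply: eq_bigr => i _; rewrite /a' pickleK.
rewrite -uniq_window_measure; last first.
  by rewrite map_inj_uniq//; exact: (pcan_inj pickleK).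
rewrite /iid_measure /= /distribution /pushforward /unit_law /mrestr.
congr lebesgue_measure; apply/seteqP; split=> u /=; rewrite /coding in_itv/=.
  move=> [us u01]; split=> //; split=> // _ /mapP[i iI ->].
  by have := us i iI; rewrite u01 /a' pickleK.
move=> [[u01 us] _]; split=> // i iI; rewrite u01 us ?map_f//.
by rewrite /a' pickleK.
Qed.

End DigitCoding.

(** * Limits of dominated set functions *)

Section RealProbability.
Context d (T : measurableType d) (R : realType) (P : probability T R).
Implicit Types A B : set T.

Definition prob A : R := fine (P A).

Lemma prE A : measurable A -> P A = (prob A)%:E.
Proof. by move=> mA; rewrite /prob fineK// fin_num_measure. Qed.

Lemma pr_ge0 A : 0 <= prob A.
Proof. by rewrite /prob fine_ge0. Qed.

Lemma pr_setT : prob setT = 1.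
Proof. by rewrite /prob probability_setT. Qed.

Lemma pr_set0 : prob set0 = 0.
Proof. by rewrite /prob measure0. Qed.

Lemma pr_le A B : measurable A -> measurable B -> A `<=` B -> prob A <= prob B.
Proof.
by move=> mA mB AB; rewrite -lee_fin -!prE// le_measure ?inE.
Qed.

Lemma pr_setD A B : measurable A -> measurable B -> B `<=` A ->
  prob (A `\` B) = prob A - prob B.
Proof.
move=> mA mB BA; apply: EFin_inj; rewrite EFinB -!prE//; last exact: measurableD.
by rewrite measureD ?setIidr//; rewrite -ge0_fin_numE// fin_num_measure.
Qed.

Lemma pr_setU A B : measurable A -> measurable B -> A `&` B = set0 ->
  prob (A `|` B) = prob A + prob B.
Proof.
move=> mA mB AB; apply: EFin_inj; rewrite EFinD -!prE//; last exact: measurableU.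
by rewrite measureU.
Qed.

Lemma pr_setU_le A B : measurable A -> measurable B ->
  prob (A `|` B) <= prob A + prob B.
Proof.
move=> mA mB; rewrite -lee_fin EFinD -!prE//; last exact: measurableU.
exact: measureU2.
Qed.

Lemma pr_setC A : measurable A -> prob (~` A) = 1 - prob A.
Proof. by move=> mA; rewrite -setTD pr_setD// pr_setT. Qed.

Lemma pr_bigcap_cvg (F : (set T)^nat) : (forall n, measurable (F n)) ->
  nonincreasing_seq F -> prob (F n) @[n --> \oo] --> prob (\bigcap_n F n).
Proof.
move=> mF niF; have mI : measurable (\bigcap_n F n) by exact: bigcapT_measurable.
suff /fine_cvgP[_] : P (F n) @[n --> \oo] --> (prob (\bigcap_n F n))%:E by [].
by rewrite -prE//; apply: nonincreasing_cvg_mu => //; rewrite -ge0_fin_numE// fin_num_measure.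
Qed.

Lemma pr_bigcap_lt (F : (set T)^nat) (e : R) : (forall n, measurable (F n)) ->
  nonincreasing_seq F -> prob (\bigcap_n F n) < e -> exists n, prob (F n) < e.
Proof.
move=> mF niF lte; have [n _ Fn] := cvgr_lt _ (pr_bigcap_cvg mF niF) _ lte.
by exists n; apply: Fn => /=.
Qed.

(** Since the [Q n] are dominated by [P], convergence on the members of an
increasing sequence of sets is carried over, uniformly in [n], to the union.
Hence the sets [A] with [Q n A --> c * prob A] form a lambda-system. Constant
sequences [Q] give independence, the others mixing. *)
Lemma product_limit (G : set (set T)) (c : R) (Q : nat -> set T -> R) :
  setI_closed G -> G `<=` measurable ->
  (forall n A B, measurable A -> measurable B -> B `<=` A ->
     Q n (A `\` B) = Q n A - Q n B) ->
  (forall n A, measurable A -> 0 <= Q n A <= prob A) ->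
  Q n setT @[n --> \oo] --> c ->
  (forall A, G A -> Q n A @[n --> \oo] --> c * prob A) ->
  forall A, <<s G >> A -> Q n A @[n --> \oo] --> c * prob A.
Proof.
move=> GI Gm Qdiff Qle QT QG.
suff GH : <<s G >> `<=`
    [set A | measurable A /\ Q n A @[n --> \oo] --> c * prob A].
  by move=> A /GH[].
apply: lambda_system_subset => //; last by move=> A GA; split; [exact: Gm|exact: QG].
split=> //.
- by split=> //; rewrite pr_setT mulr1.
- move=> A B BA [mA QA] [mB QB]; split; first exact: measurableD.
  rewrite pr_setD// mulrBr.
  under eq_fun do rewrite Qdiff//.
  exact: cvgB.
- move=> F ndF FH; have mF n : measurable (F n) := (FH n).1.
  have mU : measurable (\bigcup_n F n) by exact: bigcupT_measurable.
  split=> //; apply/cvgrPdist_lt => e e0.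
  pose D n := \bigcup_n F n `\` F n.
  have e'0 : 0 < e / 2 / (1 + `|c|) by rewrite !divr_gt0// ltr_pwDl.
  (* The part of the union missed by [F k] counts for less than [e / 2] in both
     terms, whatever [n]. *)
  have [k Dk] : exists k, prob (D k) < e / 2 / (1 + `|c|).
    apply: pr_bigcap_lt.
    + by move=> n; exact: measurableD.
    + by move=> m n mn; apply/subsetPset; apply: setDS; exact/subsetPset/ndF.
    + rewrite (_ : \bigcap_n _ = set0) ?pr_set0//.
      rewrite -subset0 => t Dt.
      have [[n _ Fnt] _] := Dt 0%N I.
      by have [_] := Dt n I.
  have Fk : F k `<=` \bigcup_n F n by exact: bigcup_sup.
  have /cvgrPdist_lt /(_ (e / 2) ltac:(by rewrite divr_gt0)) := (FH k).2.
  apply: filterS => n Qn.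
  rewrite (_ : _ - _ = (c * prob (F k) - Q n (F k)) + (c * prob (D k) - Q n (D k))).
    apply: le_lt_trans (ler_normD _ _) _.
    rewrite [ltRHS](splitr e); apply: ltr_leD => //.
    apply: le_trans (ler_normB _ _) _; rewrite normrM (ger0_norm (pr_ge0 _)).
    have /andP[Q0 Q1] := Qle n (D k) (measurableD mU (mF k)).
    rewrite (ger0_norm Q0).
    apply: (@le_trans _ _ ((1 + `|c|) * prob (D k))).
      by rewrite mulrDl mul1r addrC lerD2r.
    by rewrite mulrC -ler_pdivlMr ?ltr_pwDl// ltW.
  rewrite /D Qdiff// pr_setD//; lra.
Qed.

End RealProbability.

(** * Independence and mixing of the iid sequence *)

Section IidSequence.
Variable R : realType.
Notation iid := (iid_measure R).
Notation pr := (prob iid).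
Implicit Types (w : path_space) (I J : seq int) (a b : int -> nat).

(** The empty set makes this family stable under intersection, which two
incompatible cylinders would otherwise prevent. *)
Definition cylinders (J : set int) : set (set path_space) :=
  [set B | B = set0 \/ exists I a,
     [/\ uniq I, forall i, i \in I -> J i & B = cylinder I a]].

Lemma measurable_coordinate (i : int) (a : nat) :
  measurable [set w : path_space | w i = a].
Proof. by apply: sub_sigma_algebra; exists i, a. Qed.

Lemma measurable_cylinder I a : measurable (cylinder I a).
Proof.
rewrite (_ : cylinder I a = \bigcap_(i in [set i | i \in I]) [set w | w i = a i])//.
by apply: fin_bigcap_measurable => // i _; exact: measurable_coordinate.
Qed.

Lemma cylinders_measurable (J : set int) : cylinders J `<=` measurable.
Proof. by move=> _ [->//|[I [a [_ _ ->]]]]; exact: measurable_cylinder. Qed.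

Lemma cylinderI I J a b : (forall i, i \in I -> i \in J -> a i = b i) ->
  cylinder I a `&` cylinder J b =
  cylinder (I ++ J) (fun i => if i \in I then a i else b i).
Proof.
move=> ab; apply/seteqP; split=> w /=.
  move=> [wa wb] i; rewrite mem_cat; case: ifP => [iI _|_ /= iJ]; first exact: wa.
  exact: wb.
move=> wab; split=> i iI; have := wab i; rewrite mem_cat iI ?orbT => /(_ isT).
  by [].
by case: ifP => // iI' ->; exact: ab.
Qed.

Lemma cylinders_setI (J : set int) : setI_closed (cylinders J).
Proof.
move=> B B' [->|[I [a [uI IJ ->]]]]; first by left; rewrite set0I.
move=> [->|[I' [b [uI' I'J ->]]]]; first by left; rewrite setI0.
have [ab|nab] := pselect (forall i, i \in I -> i \in I' -> a i = b i); last first.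
  left; rewrite -subset0 => w [wa wb]; apply: nab => i iI iI'.
  by rewrite -wa// -wb.
right; exists (undup (I ++ I')), (fun i => if i \in I then a i else b i).
split; first exact: undup_uniq.
  by move=> i; rewrite mem_undup mem_cat => /orP[/IJ|/I'J].
rewrite cylinderI//; apply/seteqP; split=> w /= wab i; have := wab i;
  by rewrite mem_undup.
Qed.

Lemma pr_cylinder I a : uniq I -> pr (cylinder I a) = \prod_(i <- I) geom R (a i).
Proof. by move=> uI; rewrite /prob iid_measure_cylinder. Qed.

Lemma pr_cylinderI I J a b : uniq I -> uniq J ->
  (forall i, i \in I -> i \notin J) ->
  pr (cylinder I a `&` cylinder J b) = pr (cylinder I a) * pr (cylinder J b).
Proof.
move=> uI uJ IJ; rewrite cylinderI; last by move=> i /IJ/negbTE ->.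
rewrite !pr_cylinder//; last first.
  rewrite cat_uniq uI uJ andbT/=; apply/hasPn => i iJ.
  by apply/negP => /IJ; rewrite iJ.
rewrite big_cat/=; congr (_ * _); rewrite !big_seq; apply: eq_bigr => i iI.
  by rewrite iI.
by case: ifP => // /IJ; rewrite iI.
Qed.

Lemma coordinate_cylinder (i : int) (a : nat) :
  [set w : path_space | w i = a] = cylinder [:: i] (fun=> a).
Proof.
apply/seteqP; split=> w /= => [<- j|]; first by rewrite inE => /eqP ->.
by apply; rewrite inE.
Qed.

Lemma pr_coordinate (i : int) (a : nat) :
  pr [set w : path_space | w i = a] = geom R a.
Proof. by rewrite coordinate_cylinder pr_cylinder// big_seq1. Qed.

Lemma coordinate_cylinders (J : set int) (i : int) (a : nat) : J i ->
  cylinders J [set w | w i = a].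
Proof.
move=> Ji; right; exists [:: i], (fun=> a); split=> //.
  by move=> j; rewrite inE => /eqP ->.
exact: coordinate_cylinder.
Qed.

Lemma measurable_cylinders : measurable = <<s cylinders setT >>.
Proof.
apply/seteqP; split; apply: smallest_sub; try exact: smallest_sigma_algebra.
  by move=> _ [i [a ->]]; apply: sub_sigma_algebra; exact: coordinate_cylinders.
exact: cylinders_measurable.
Qed.

Definition translate (m : int) (w : path_space) : path_space := fun i => w (i + m).

Lemma measurable_translate m : measurable_fun setT (translate m).
Proof.
apply: (@measurability _ _ _ path_space _ _ coordinate_sets) =>
  // _ [B [i [a ->]] <-].
by rewrite setTI; exact: measurable_coordinate.
Qed.

HB.instance Definition _ m :=
  isMeasurableFun.Build _ _ _ _ (translate m) (measurable_translate m).

Lemma translate_measurable m (A : set path_space) :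
  measurable A -> measurable (translate m @^-1` A).
Proof. by move=> mA; rewrite -(setTI (_ @^-1` _)); exact: measurable_translate. Qed.

Lemma translate_cylinder m I a : translate m @^-1` cylinder I a =
  cylinder [seq i + m | i <- I] (fun i => a (i - m)).
Proof.
apply/seteqP; split=> w /= wI i; first by move=> /mapP[j jI ->]; rewrite addrK; exact: wI.
move=> iI; have := wI (i + m); rewrite addrK; apply; exact: (map_f (+%R^~ m)).
Qed.

(** A translation permutes the cylinders and preserves the product of the
weights. *)
Lemma iid_measure_translate m (A : set path_space) : measurable A ->
  iid (translate m @^-1` A) = iid A.
Proof.
move=> mA; apply/esym.
apply: (measure_unique (cylinders setT) (fun=> setT) measurable_cylinders
  (@cylinders_setI _) _ _ iid (distribution iid (translate m))) => //.
- move=> _; right; exists [::], (fun=> 0%N); split=> //.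
  by apply/seteqP; split.
- by apply/seteqP; split=> // w _; exists 0%N.
- move=> _ [->|[I [a [uI _ ->]]]]; first by rewrite !measure0.
  transitivity (iid (translate m @^-1` cylinder I a)) => //.
  rewrite translate_cylinder iid_measure_cylinder//.
    apply: etrans (iid_measure_cylinder R a uI) _; rewrite big_map; congr EFin.
    by apply: eq_bigr => i _; rewrite addrK.
  by rewrite map_inj_uniq//; exact: addIr.
- by move=> _; apply: le_lt_trans (probability_le1 iid measurableT) _; rewrite ltry.
Qed.

Lemma pr_translate m (A : set path_space) : measurable A ->
  pr (translate m @^-1` A) = pr A.
Proof. by move=> mA; rewrite /prob iid_measure_translate. Qed.

Lemma int_seq_bounded I : exists M : nat, forall i, i \in I -> (`|i| <= M)%N.
Proof.
elim: I => [|i I [M IM]]; first by exists 0%N.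
exists (maxn `|i| M) => j; rewrite inE => /orP[/eqP ->|/IM]; lia.
Qed.

(** Cylinders become independent as soon as the translation has moved their
times apart. [product_limit] extends this first to all [A] for a fixed cylinder
[D], then to all [D] for a fixed [A]. *)
Lemma mixing (A D : set path_space) : measurable A -> measurable D ->
  pr (A `&` translate n%:Z @^-1` D) @[n --> \oo] --> pr A * pr D.
Proof.
have mt n B : measurable B -> measurable (translate n%:Z @^-1` B).
  exact: translate_measurable.
have cyl I J a b : uniq I -> uniq J ->
    pr (cylinder I a `&` translate n%:Z @^-1` cylinder J b) @[n --> \oo] -->
    pr (cylinder I a) * pr (cylinder J b).
  move=> uI uJ; have [M IM] := int_seq_bounded I; have [N JN] := int_seq_bounded J.
  apply: (@cvg_near_cst _ _ _ _ _); near=> n.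
  rewrite translate_cylinder pr_cylinderI//.
  - by rewrite -translate_cylinder pr_translate//; exact: measurable_cylinder.
  - by rewrite map_inj_uniq//; exact: addIr.
  - move=> i iI; apply/negP => /mapP[j jJ ij].
    have := IM _ iI; have := JN _ jJ.
    have : (M + N < n)%N by near: n; exact: nbhs_infty_gt.
    lia.
move=> mA mD.
have step D' : cylinders setT D' -> forall A', measurable A' ->
    pr (A' `&` translate n%:Z @^-1` D') @[n --> \oo] --> pr D' * pr A'.
  move=> cD A' mA'; have mD' := cylinders_measurable cD.
  apply: (product_limit (G := cylinders setT)
    (Q := fun n B => pr (B `&` translate n%:Z @^-1` D'))).
  - exact: cylinders_setI.
  - exact: cylinders_measurable.
  - move=> n B C mB mC CB; rewrite -pr_setD.
    + by congr pr; apply/seteqP; split=> w /=; tauto.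
    + by apply: measurableI => //; exact: mt.
    + by apply: measurableI => //; exact: mt.
    + exact: setSI.
  - move=> n B mB; rewrite pr_ge0/=; apply: pr_le => //.
    by apply: measurableI => //; exact: mt.
  - by under eq_fun do rewrite setTI pr_translate//; exact: cvg_cst.
  - move=> B; case: cD => [->|[J [b [uJ _ ->]]]].
      by move=> _; under eq_fun do rewrite preimage_set0 setI0;
        rewrite pr_set0 mul0r; exact: cvg_cst.
    move=> [->|[I [a [uI _ ->]]]]; last by rewrite mulrC; exact: cyl.
    by under eq_fun do rewrite set0I; rewrite pr_set0 mulr0; exact: cvg_cst.
  - by rewrite -measurable_cylinders.
apply: (product_limit (G := cylinders setT)
    (Q := fun n B => pr (A `&` translate n%:Z @^-1` B))).
- exact: cylinders_setI.
- exact: cylinders_measurable.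
- move=> n B C mB mC CB; rewrite -pr_setD.
  + by congr pr; apply/seteqP; split=> w /=; tauto.
  + by apply: measurableI => //; exact: mt.
  + by apply: measurableI => //; exact: mt.
  + by move=> w [Aw /CB].
- move=> n B mB; rewrite pr_ge0/= -[leRHS](pr_translate n%:Z mB); apply: pr_le.
  + by apply: measurableI => //; exact: mt.
  + exact: mt.
  + by move=> w [].
- by under eq_fun do rewrite preimage_setT setIT; exact: cvg_cst.
- by move=> B cB; rewrite mulrC; exact: step.
- by rewrite -measurable_cylinders.
Unshelve. all: by end_near. Qed.

Definition coordinates (J : set int) : set (set path_space) :=
  [set B | exists (i : int) (a : nat),
     J i /\ B = [set w : path_space | w i = a]].

Definition sigma_of (J : set int) : set (set path_space) := <<s coordinates J >>.

Lemma sigma_ofI (J : set int) (A B : set path_space) :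
  sigma_of J A -> sigma_of J B -> sigma_of J (A `&` B).
Proof. exact: (@measurableI _ (g_sigma_algebraType (coordinates J))). Qed.

Lemma sigma_ofC (J : set int) (A : set path_space) :
  sigma_of J A -> sigma_of J (~` A).
Proof. exact: (@measurableC _ (g_sigma_algebraType (coordinates J))). Qed.

Lemma sigma_of_measurable (J : set int) : sigma_of J `<=` measurable.
Proof.
apply: smallest_sub; first exact: sigma_algebra_measurable.
by move=> _ [i [a [_ ->]]]; exact: measurable_coordinate.
Qed.

(** The case of a constant sequence in [product_limit]. *)
Lemma pr_indep_coordinate (J : set int) (j : int) (y : nat) (A : set path_space) :
  ~ J j -> sigma_of J A -> pr (A `&` [set w | w j = y]) = pr A * geom R y.
Proof.
move=> Jj JA; have mj := measurable_coordinate j y.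
rewrite -(pr_coordinate j) mulrC.
suff : (fun=> pr (A `&` [set w | w j = y])) @ \oo --> pr [set w | w j = y] * pr A.
  by move=> /(cvg_unique _ (cvg_cst _)); apply.
apply: (product_limit (G := cylinders J)
  (Q := fun _ B => pr (B `&` [set w | w j = y]))).
- exact: cylinders_setI.
- exact: cylinders_measurable.
- move=> _ B C mB mC CB; rewrite -pr_setD.
  + by congr pr; apply/seteqP; split=> w /=; tauto.
  + exact: measurableI.
  + exact: measurableI.
  + exact: setSI.
- by move=> _ B mB; rewrite pr_ge0/=; apply: pr_le => //; exact: measurableI.
- by rewrite setTI; exact: cvg_cst.
- move=> _ [->|[I [a [uI IJ ->]]]].
    by rewrite set0I pr_set0 mulr0; exact: cvg_cst.
  rewrite mulrC coordinate_cylinder pr_cylinderI//; first exact: cvg_cst.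
  move=> i /IJ Ji; rewrite inE; apply/eqP => ij; by rewrite ij in Ji.
- move: A JA; apply: smallest_sub; first exact: smallest_sigma_algebra.
  move=> _ [i [a [Ji ->]]]; apply: sub_sigma_algebra; exact: coordinate_cylinders.
Qed.

End IidSequence.

(** Finitely many times see countably many words, so that an event that they
decide is a countable union of events fixing a word. *)
Lemma sigma_of_local (I : seq int) (J : set int) (B : set path_space) :
  (forall i, i \in I -> J i) ->
  (forall w w' : path_space, (forall i, i \in I -> w i = w' i) -> B w -> B w') ->
  sigma_of J B.
Proof.
move=> IJ Bloc.
pose T := g_sigma_algebraType (coordinates J).
have fiber s : @measurable _ T [set w | map w I = s].
  elim: I IJ {Bloc} s => [|i I IH] IJ s.
    case: s => [|a s].
      by rewrite (_ : [set _ | _] = setT)//; apply/seteqP; split.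
    by rewrite (_ : [set _ | _] = set0)//; apply/seteqP; split.
  case: s => [|a s]; first by rewrite (_ : [set _ | _] = set0)//; apply/seteqP; split.
  rewrite (_ : [set _ | _] = [set w : T | w i = a] `&` [set w | map w I = s]).
    apply: measurableI; last by apply: IH => j jI; apply: IJ; rewrite inE jI orbT.
    by apply: sub_sigma_algebra; exists i, a; split=> //; apply: IJ; rewrite inE eqxx.
  by apply/seteqP; split=> w /= => [[-> ->]|[-> ->]].
suff : @measurable _ T B by [].
rewrite (_ : B = \bigcup_(s : seq nat)
    (if `[< exists w : path_space, B w /\ map w I = s >]
     then [set w | map w I = s] else set0)).
  apply: countable_bigcupT_measurable => [|s]; first exact: countableP.
  by case: ifP.
apply/seteqP; split=> w /=.
  move=> Bw; exists (map w I) => //; case: asboolP => //=.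
  by move=> /forallNP/(_ w) [].
move=> [s _]; case: asboolP => //= -[w' [Bw' w's]] ws; apply: Bloc Bw' => i iI.
by move: w's; rewrite -ws => /eq_in_map; apply.
Qed.

Lemma measurable_local (I : seq int) (B : set path_space) :
  (forall w w' : path_space, (forall i, i \in I -> w i = w' i) -> B w -> B w') ->
  measurable B.
Proof.
by move=> Bloc; apply: (@sigma_of_measurable setT); exact: (@sigma_of_local I).
Qed.

(** * Marking the zeros that follow a pattern *)

Section Marking.
Variable c : nat -> nat.
Implicit Types (w : int -> nat) (i m : int) (a u v : nat).

(** Patterns are made of letters above 1, and marking touches only 0 and 1; so
marking neither creates nor destroys a pattern. *)
Definition pattern u v : bool := [&& (1 < u)%N, (1 < v)%N & c v == u].

Definition marked w : int -> nat :=
  fun i => if (w i == 0%N) && pattern (w (i - 2)) (w (i - 1)) then 1%N else w i.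

Lemma marked_eq w i a : (1 < a)%N -> (marked w i == a) = (w i == a).
Proof.
rewrite /marked; case: ifP => // /andP[/eqP -> _].
by case: a => [|[]].
Qed.

Lemma pattern_marked w i m :
  pattern (marked w i) (marked w m) = pattern (w i) (w m).
Proof.
have big j : (1 < marked w j)%N = (1 < w j)%N.
  by rewrite /marked; case: ifP => // /andP[/eqP -> _].
have same j : (1 < w j)%N -> marked w j = w j.
  by move=> wj; apply/eqP; rewrite marked_eq.
rewrite /pattern !big; have [wi /=|//] := boolP (1 < w i)%N.
by have [wm /=|//] := boolP (1 < w m)%N; rewrite !same.
Qed.

Lemma marked_local w w' i : w i = w' i -> w (i - 1) = w' (i - 1) ->
  w (i - 2) = w' (i - 2) -> marked w i = marked w' i.
Proof. by rewrite /marked => -> -> ->. Qed.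

Lemma marked_translate m (w : path_space) i :
  marked (translate m w) i = marked w (i + m).
Proof. by rewrite /marked /translate ![i - _ + m]addrAC. Qed.

(** A marked letter is decided by three consecutive letters. *)
Lemma marked_sigma (n : int) i (Y : set nat) : i <= n ->
  sigma_of [set j | j <= n] [set w : path_space | Y (marked w i)].
Proof.
move=> le_in; apply: (@sigma_of_local [:: i; i - 1; i - 2]).
  by move=> j; rewrite !inE => /or3P[] /eqP -> /=; lia.
by move=> w w' ww' /=; rewrite (@marked_local w w' i)//; apply: ww';
  rewrite !inE eqxx ?orbT.
Qed.

Definition marked_coord i (w : path_space) : nat := marked w i.

Lemma measurable_marked_coord i : measurable_fun setT (marked_coord i).
Proof.
move=> _ Y _; rewrite setTI; apply: (@sigma_of_measurable [set j | j <= i]).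
exact: marked_sigma.
Qed.

HB.instance Definition _ i :=
  isMeasurableFun.Build _ _ _ _ (marked_coord i) (measurable_marked_coord i).

Lemma measurable_marked :
  measurable_fun setT (marked : path_space -> path_space).
Proof.
apply: (@measurability _ _ _ path_space _ _ coordinate_sets) =>
  // _ [B [i [a ->]] <-].
rewrite setTI; apply: (@sigma_of_measurable [set j | j <= i]).
exact: (@marked_sigma i i [set a]).
Qed.

End Marking.

Lemma integral_two_values d (T : measurableType d) (R : realType)
    (P : probability T R) (A : set T) (b : T -> bool) (x y : R) :
  measurable A -> measurable [set t | b t] ->
  (\int[P]_(t in A) (if b t then x else y)%:E)%E =
  (prob P (A `&` [set t | b t]) * x + prob P (A `\` [set t | b t]) * y)%:E.
Proof.
move=> mA mb; set B := [set t | b t].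
have mAB : measurable (A `&` B) by exact: measurableI.
have mAC : measurable (A `\` B) by exact: measurableD.
have AE : A = (A `&` B) `|` (A `\` B) by rewrite setDE -setIUr setUv setIT.
rewrite [X in (\int[P]_(t in X) _)%E]AE integral_setU//.
- rewrite (eq_integral (cst x%:E)); last first.
    by move=> t; rewrite inE => -[_ /= ->].
  rewrite integral_cst// (eq_integral (cst y%:E)); last first.
    by move=> t; rewrite inE => -[_ /= /negP/negbTE ->].
  rewrite integral_cst// EFinD; congr (_ + _)%E; rewrite mulrC EFinM; congr (_ * _)%E;
    exact: prE.
- apply: (measurable_funS measurableT) => //.
  move=> _ Y _; rewrite setTI.
  have mcst (Q : Prop) : measurable [set _ : T | Q].
    have [q|q] := pselect Q; first by rewrite (_ : [set _ | _] = setT)//; apply/seteqP; split.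
    by rewrite (_ : [set _ | _] = set0)//; apply/seteqP; split.
  rewrite (_ : _ @^-1` Y = (B `&` [set _ | Y x%:E]) `|` (~` B `&` [set _ | Y y%:E])).
    by apply: measurableU; apply: measurableI => //; exact: measurableC.
  apply/seteqP; split=> t /=; rewrite /B /=.
    by case: ifP => [bt Yx|/negbT/negP bt Yy]; [left|right].
  by move=> [[-> //]|[/negP/negbTE ->]].
- by apply/disj_set2P; rewrite -subset0 => t /= [[_ Bt] [_]].
Qed.

(** * The marked sequence is a stationary ergodic Markov chain *)

Section MarkedProcess.
Variables (R : realType) (c : nat -> nat).
Notation iid := (iid_measure R).
Notation pr := (prob iid).

Definition marked_process (i : int) : {RV iid >-> nat} := marked_coord c i.

Lemma string_event_translate (m : int) (s : seq nat) :
  string_event marked_process m s = translate m @^-1` string_event marked_process 0 s.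
Proof.
apply/seteqP; split=> w /= ws i si; have := ws i si;
  by rewrite /marked_process /= /marked_coord marked_translate addrC ?add0r ?addr0 // addrC.
Qed.

Lemma measurable_string_event (m : int) (s : seq nat) :
  measurable (string_event marked_process m s).
Proof.
rewrite (_ : string_event _ _ _ = \bigcap_(i in [set i | (i < size s)%N])
   [set w : path_space | marked c w (m + i%:Z) = nth 0%N s i])//.
apply: bigcap_measurableType => i _.
apply: (@sigma_of_measurable [set j | j <= m + i%:Z]).
exact: (@marked_sigma _ _ _ [set nth 0%N s i]).
Qed.

Lemma stationary_process : stationary marked_process.
Proof.
move=> m s; rewrite string_event_translate iid_measure_translate//.
exact: measurable_string_event.
Qed.

(** The marking commutes with translations, so that an invariant event pulls
back to an invariant event of the iid sequence; mixing makes the square of its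
probability equal to this probability. *)
Lemma ergodic_process : ergodic marked_process.
Proof.
move=> B mB Binv; pose A : set path_space := marked c @^-1` B.
have mA : measurable A by rewrite /A -(setTI (_ @^-1` _)); exact: measurable_marked.
have shiftE (w : int -> nat) : marked c (translate 1 w) = shift_seq (marked c w).
  by apply/funext => i; rewrite marked_translate.
have Bi x : B (shift_seq x) = B x by rewrite -{2}Binv.
have A1 : translate 1 @^-1` A = A.
  by apply/seteqP; split=> w; rewrite /A /= shiftE Bi.
have An n : translate n%:Z @^-1` A = A.
  elim: n => [|n IH].
    by apply/seteqP; split=> w; rewrite /= (_ : translate 0 w = w)//;
      apply/funext => i; rewrite /translate addr0.
  rewrite -[RHS]IH -{2}A1; apply/seteqP; split=> w;
    rewrite /= (_ : translate n.+1%:Z w = translate 1 (translate n%:Z w))//;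
    by apply/funext => i; rewrite /translate -addrA -intS.
have cA : pr (A `&` translate n%:Z @^-1` A) @[n --> \oo] --> pr A.
  by under eq_fun do rewrite An setIid; exact: cvg_cst.
have sq : pr A * pr A = pr A.
  exact: (cvg_unique _ (mixing mA mA) cA).
move/eqP: sq; rewrite -subr_eq0 -{3}[pr A]mulr1 -mulrBr mulf_eq0 subr_eq0.
change (path_of marked_process @^-1` B) with A.
by rewrite prE// => /orP[] /eqP; [left|right]; congr EFin.
Qed.



Lemma past_sigma_process (n : int) (A : set path_space) :
  past_sigma marked_process n A -> sigma_of [set j | j <= n] A.
Proof.
move: A; apply: smallest_sub; first exact: smallest_sigma_algebra.
by move=> _ [i [a [le_in ->]]]; exact: (@marked_sigma c n i [set a]).
Qed.

(** After a pattern the mass of the letter 0 goes to the letter 1. *)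
Definition after_pattern (y : nat) : R :=
  match y with 0 => 0 | 1 => geom R 0 + geom R 1 | _ => geom R y end.

(** The next letter is [w (n + 1)], possibly marked, and [w (n + 1)] is
independent of the past; only the presence of a pattern at time [n] matters. *)
Lemma pr_next (n : int) (y : nat) (A : set path_space) (b : bool) :
  sigma_of [set j | j <= n] A ->
  (forall w, A w -> pattern c (w (n - 1)) (w n) = b) ->
  pr (A `&` marked_process (n + 1) @^-1` [set y]) =
  pr A * if b then after_pattern y else geom R y.
Proof.
move=> sA Ab.
have indep x : pr (A `&` [set w | w (n + 1) = x]) = pr A * geom R x.
  by apply: pr_indep_coordinate sA => /=; rewrite gerDl.
have next w : A w -> marked_process (n + 1) w =
    if (w (n + 1) == 0%N) && b then 1%N else w (n + 1).
  move=> /Ab <-; rewrite /marked_process /= /marked_coord /marked.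
  by rewrite (_ : n + 1 - 2 = n - 1) ?addrK//; lia.
have mA : measurable A := sigma_of_measurable sA.
case: b next {Ab} => next; last first.
  rewrite -indep; congr (prob _ _); apply/seteqP; split=> w /= [Aw];
    by rewrite (next _ Aw) andbF.
have mco x : measurable (A `&` [set w | w (n + 1) = x]).
  by apply: measurableI => //; exact: measurable_coordinate.
case: y => [|[|y]] /=.
- rewrite mulr0 (_ : _ `&` _ = set0) ?pr_set0// -subset0 => w /= [Aw].
  by rewrite (next _ Aw) andbT; case: eqP.
- rewrite mulrDr -!indep -pr_setU//; last first.
    by rewrite -subset0 => w /= [[_ ->] []].
  congr (prob _ _); apply/seteqP; split=> w /=.
    by move=> [Aw]; rewrite (next _ Aw) andbT; case: eqP => [|_]; [left|right].
  by move=> [] [Aw wn]; split=> //; rewrite (next _ Aw) wn.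
- rewrite -indep; congr (prob _ _); apply/seteqP; split=> w /= [Aw].
    by rewrite (next _ Aw) andbT; case: eqP.
  by move=> wn; split=> //; rewrite (next _ Aw) wn.
Qed.

Lemma sigma_of_pattern (n : int) :
  sigma_of [set j | j <= n] [set w : path_space | pattern c (w (n - 1)) (w n)].
Proof.
apply: (@sigma_of_local [:: n; n - 1]).
  by move=> j; rewrite !inE => /orP[] /eqP -> /=; lia.
by move=> w w' ww' /=; rewrite !ww' ?inE ?eqxx ?orbT.
Qed.

Lemma depends_on_last2_process : depends_on_last marked_process 2.
Proof.
move=> n y; exists (fun s => if pattern c (nth 0%N s 0) (nth 0%N s 1)
  then after_pattern y else geom R y) => A /past_sigma_process sA.
have mA := sigma_of_measurable sA.
pose B := [set w : path_space | pattern c (w (n - 1)) (w n)].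
have sB : sigma_of [set j | j <= n] B by exact: sigma_of_pattern.
have mB := sigma_of_measurable sB.
have mX : measurable (marked_process (n + 1) @^-1` [set y]).
  exact: measurable_funPTI.
transitivity (\int[iid]_(w in A) (if pattern c (w (n - 1)) (w n)
    then after_pattern y else geom R y)%:E)%E; last first.
  apply: eq_integral => w _; rewrite /suffix_at /mkseq /= /path_of /marked_process /=.
  rewrite /marked_coord pattern_marked.
  by rewrite (_ : n - 2 + 1 + 0 = n - 1) 1?(_ : n - 2 + 1 + 1 = n)//; lia.
rewrite integral_two_values// -/B.
have sAB := sigma_ofI sA sB; have sAC := sigma_ofI sA (sigma_ofC sB).
rewrite -(@pr_next n y _ true)//; last by move=> w [].
rewrite setDE -(@pr_next n y _ false)//; last by move=> w [_ /negP/negbTE].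
rewrite prE; last exact: measurableI.
congr EFin; rewrite -pr_setU.
- by rewrite -setIUl -setIUr setUv setIT.
- by apply: measurableI => //; exact: sigma_of_measurable sAB.
- by apply: measurableI => //; exact: sigma_of_measurable sAC.
- by rewrite -subset0 => w /= [[[_ ?] _] [[_ ?] _]].
Qed.

End MarkedProcess.

(** * Memory lengths of the marked sequence *)

Section Memory.
Variables (R : realType) (c : nat -> nat).
Notation iid := (iid_measure R).
Notation pr := (prob iid).
Notation X := (marked_process R c).

Lemma memory_length_le1 (x : int -> nat) (m : int) :
  memory_suffices X [:: x m] -> (memory_length X x m <= 1)%E.
Proof.
move=> suff1; apply: ereal_inf_lbound; exists 1%N => //=.
by rewrite /suffix_at /mkseq /= (_ : m - 1 + 1 + 0 = m)//; lia.
Qed.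

Lemma memory_length_ge2 (x : int -> nat) (m : int) :
  ~ memory_suffices X [::] -> ~ memory_suffices X [:: x m] ->
  (2%:E <= memory_length X x m)%E.
Proof.
move=> suff0 suff1; apply: le_ereal_inf_tmp => _ [[|[|k]] /= suffk <-] //.
  by exfalso; move: suffk; rewrite /suffix_at /mkseq /=
    (_ : m - 1 + 1 + 0 = m)//; lia.
by rewrite lee_fin ler_nat.
Qed.

Lemma string_event_rcons (m : int) (s : seq nat) (y : nat) :
  string_event X m (rcons s y) =
  string_event X m s `&` X (m + (size s)%:Z) @^-1` [set y].
Proof.
apply/seteqP; split=> w /=.
  move=> ws; split=> [i si|].
    by have := ws i; rewrite size_rcons nth_rcons si; apply; rewrite ltnW.
  by have := ws (size s); rewrite size_rcons nth_rcons ltnn eqxx; apply.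
move=> [ws wy] i; rewrite size_rcons ltnS nth_rcons.
by case: ltngtP => // [si _|-> _]; [exact: ws|exact: wy].
Qed.

Lemma sigma_of_string_event (m n : int) (s : seq nat) :
  m + (size s)%:Z - 1 <= n ->
  sigma_of [set j | j <= n] (string_event X m s).
Proof.
elim/last_ind: s n => [|s y IH] n.
  move=> _; rewrite (_ : string_event _ _ _ = setT); last first.
    by apply/seteqP; split.
  by apply: (@sigma_of_local [::]).
rewrite size_rcons string_event_rcons => mn; apply: sigma_ofI.
  by apply: IH; lia.
by apply: (@marked_sigma c n _ [set y]); lia.
Qed.

Lemma prob_ending_rcons (s : seq nat) (y : nat) (b : bool) :
  (forall w, string_event X (0 - (size s)%:Z + 1) s w ->
     pattern c (w (-1)) (w 0) = b) ->
  prob_ending X 1 (rcons s y) =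
  prob_ending X 0 s * if b then after_pattern R y else geom R y.
Proof.
move=> sb; rewrite /prob_ending size_rcons.
rewrite (_ : 1 - _ + 1 = 0 - (size s)%:Z + 1); last by lia.
rewrite string_event_rcons (_ : _ + (size s)%:Z = 0 + 1); last by lia.
rewrite -/(prob iid _) (@pr_next R c 0 y _ b)//.
by apply: sigma_of_string_event; lia.
Qed.

Lemma cond_prob_off_pattern (s : seq nat) (y : nat) :
  (forall w, string_event X (0 - (size s)%:Z + 1) s w ->
     pattern c (w (-1)) (w 0) = false) ->
  prob_ending X 0 s != 0 -> cond_prob X y s = geom R y.
Proof.
move=> soff s0; rewrite /cond_prob (@prob_ending_rcons s y false)//.
by rewrite mulrC mulKf.
Qed.

Lemma prob_ending_letter a : (1 < a)%N -> prob_ending X 0 [:: a] = geom R a.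
Proof.
move=> a1; rewrite /prob_ending /= -(pr_coordinate R 0); congr (prob _ _).
apply/seteqP; split=> w /=.
  move=> /(_ 0%N isT) /eqP; rewrite marked_eq// => /eqP /=.
  by rewrite (_ : 0 - 1 + 1 + 0 = 0).
move=> wa [|i]//= _; apply/eqP; rewrite marked_eq//; apply/eqP.
by rewrite (_ : 0 - 1 + 1 + 0 = 0).
Qed.

(** No context makes a pattern out of a letter without partner, so the next
letter always has the geometric law. *)
Lemma memory_suffices_letter a : (1 < a)%N ->
  (forall b, ~~ pattern c b a) -> memory_suffices X [:: a].
Proof.
move=> a1 nopat z y z0 pos.
have off t : forall w, string_event X (0 - (size (t ++ [:: a]))%:Z + 1) (t ++ [:: a]) w ->
     pattern c (w (-1)) (w 0) = false.
  move=> w ws; have := ws (size t); rewrite nth_cat ltnn subnn size_cat addn1 ltnS.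
  move=> /(_ (leqnn _)).
  rewrite (_ : 0 - _ + 1 + _ = 0); last by lia.
  rewrite /marked_process /= /marked_coord => wa.
  by rewrite -(pattern_marked c w) wa; exact/negbTE/nopat.
have nz : prob_ending X 0 (z ++ [:: a]) != 0.
  apply/negP => /eqP z_0; move: pos.
  by rewrite (@prob_ending_rcons _ y false) ?z_0 ?mul0r ?ltxx//; exact: off.
rewrite (cond_prob_off_pattern y (off z) nz).
rewrite (@cond_prob_off_pattern [:: a] y (off [::]))//.
by rewrite prob_ending_letter// gt_eqF// geom_gt0.
Qed.

Section WithPattern.
Variables a b : nat.
Hypothesis pat : pattern c b a.

Let a1 : (1 < a)%N. Proof. by case/and3P: pat. Qed.
Let b1 : (1 < b)%N. Proof. by case/and3P: pat. Qed.

Definition other_letter := if b == 2%N then 3%N else 2%N.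
Let b'1 : (1 < other_letter)%N. Proof. by rewrite /other_letter; case: ifP. Qed.

Let nopat : ~~ pattern c other_letter a.
Proof.
rewrite /pattern; case/and3P: pat => _ _ /eqP ->; rewrite b'1 a1 /=.
by rewrite /other_letter; case: (b =P 2%N) => [-> //|/eqP].
Qed.

Definition pair_event u : set path_space := [set w | w (-1) = u /\ w 0 = a].

Lemma pair_eventE u : (1 < u)%N ->
  pair_event u = X (-1) @^-1` [set u] `&` X 0 @^-1` [set a].
Proof.
move=> u1; rewrite /pair_event; apply/seteqP; split=> w /=.
  by move=> [wu wa]; split; apply/eqP; rewrite /marked_coord marked_eq//; apply/eqP.
rewrite /marked_coord => -[/eqP + /eqP].
by rewrite !marked_eq// => /eqP -> /eqP ->.
Qed.

Lemma pair_event_sigma u : sigma_of [set j | j <= 0] (pair_event u).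
Proof.
apply: (@sigma_of_local [:: 0; -1]).
  by move=> j; rewrite !inE => /orP[] /eqP ->.
by move=> w w' ww'; rewrite /pair_event /= !ww' ?inE ?eqxx ?orbT.
Qed.

Lemma pr_pair_event u : pr (pair_event u) = geom R u * geom R a.
Proof.
transitivity (pr (cylinder [:: -1; 0] (fun i => if i == 0 then a else u))).
  congr (prob _ _); apply/seteqP; split=> w /=.
    by move=> [wu wa] i; rewrite !inE => /orP[] /eqP -> /=.
  by move=> wua; split; [apply: (wua (-1))|apply: (wua 0)]; rewrite !inE eqxx ?orbT.
by rewrite pr_cylinder// !big_cons big_nil mulr1.
Qed.

Lemma pr_pair_event_gt0 u : 0 < pr (pair_event u).
Proof. by rewrite pr_pair_event mulr_gt0// geom_gt0. Qed.

Lemma pr_pair_next0 u : pr (pair_event u `&` X 1 @^-1` [set 0%N]) =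
  if pattern c u a then 0 else pr (pair_event u) * geom R 0.
Proof.
rewrite -[1]add0r (@pr_next R c 0 0 _ (pattern c u a)).
- by case: ifP; rewrite ?mulr0.
- exact: pair_event_sigma.
- by move=> w [-> ->].
Qed.

(** A shorter memory could not tell the pattern [(b, a)] from the pair
[(other_letter, a)], but 0 follows the latter with positive probability and
never follows the former. *)
Lemma not_depends_on_last (j : nat) : (j < 2)%N -> ~ depends_on_last X j.
Proof.
move=> j2 /(_ 0 0%N) [q qP].
have past u : (1 < u)%N -> past_sigma X 0 (pair_event u).
  move=> u1; rewrite (pair_eventE u1).
  apply: (@measurableI _ (g_sigma_algebraType
    [set B | exists (i : int) (a : nat), i <= 0 /\ B = X i @^-1` [set a]]));
  apply: sub_sigma_algebra.
    by exists (-1), u.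
  by exists 0, a.
pose q0 := q (if j == 0%N then [::] else [:: a]).
have eq_q u : (1 < u)%N ->
    pr (pair_event u `&` X 1 @^-1` [set 0%N]) = q0 * pr (pair_event u).
  move=> u1; have := qP _ (past u u1).
  have mu := sigma_of_measurable (pair_event_sigma u).
  rewrite (eq_integral (cst q0%:E)).
    rewrite integral_cst// add0r prE => [E|].
      by apply: EFin_inj; rewrite E EFinM; congr (_ * _)%E; exact: prE.
    by apply: measurableI => //; exact: measurable_funPTI.
  move=> w; rewrite inE => -[wu wa]; rewrite /q0; congr (q _)%:E.
  case: j j2 {qP q0} => [|[|]]// _; rewrite /suffix_at /mkseq /=.
  rewrite (_ : 0 - 1 + 1 + 0 = 0)// /path_of /= /marked_coord.
  by rewrite (eqP (_ : marked c w 0 == a))// marked_eq// wa.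
have q0_0 : q0 = 0.
  have := eq_q b b1; rewrite pr_pair_next0 pat => /esym/eqP.
  by rewrite mulf_eq0 (gt_eqF (pr_pair_event_gt0 b)) orbF => /eqP.
have := eq_q _ b'1; rewrite pr_pair_next0 (negbTE nopat) q0_0 mul0r => /eqP.
by rewrite mulf_eq0 !gt_eqF ?pr_pair_event_gt0 ?geom_gt0.
Qed.

(** After the context [z ++ s] the letter 0 keeps its full weight [geom R 0]; so
[s] does not suffice if it makes 0 less likely than that. *)
Lemma not_memory_suffices s z : (0 < size z)%N -> z ++ s = [:: other_letter; a] ->
  0 < prob_ending X 0 s ->
  prob_ending X 1 (rcons s 0%N) < prob_ending X 0 s * geom R 0 ->
  ~ memory_suffices X s.
Proof.
move=> z0 zs s0 slt /(_ z 0%N z0).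
have evE : string_event X (0 - 2 + 1) [:: other_letter; a] = pair_event other_letter.
  rewrite (pair_eventE b'1); apply/seteqP; split=> w /=.
    by move=> ws; split; [exact: (ws 0%N)|exact: (ws 1%N)].
  by move=> [wb wa] [|[|]].
have off w : string_event X (0 - (size (z ++ s))%:Z + 1) (z ++ s) w ->
     pattern c (w (-1)) (w 0) = false.
  by rewrite zs evE => -[-> ->]; exact/negbTE.
have zs0 : prob_ending X 0 (z ++ s) = pr (pair_event other_letter).
  by rewrite zs /prob_ending evE.
rewrite (cond_prob_off_pattern 0 off) ?zs0 ?gt_eqF ?pr_pair_event_gt0//.
rewrite (@prob_ending_rcons _ 0 false)// zs0.
rewrite mulr_gt0 ?pr_pair_event_gt0 ?geom_gt0// => /(_ isT).
move=> /eqP; rewrite /cond_prob lt_eqF//.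
by rewrite ltr_pdivrMr// mulrC.
Qed.

Let pat_then_0 := cylinder [:: -1; 0; 1]
  (fun i => if i == -1 then b else if i == 0 then a else 0%N).

Let pr_pat_then_0 : 0 < pr pat_then_0.
Proof. by rewrite pr_cylinder// !big_cons big_nil mulr1 !mulr_gt0// geom_gt0. Qed.

Let pat_then_0_off w : pat_then_0 w -> marked c w 1 != 0%N.
Proof.
move=> wp; have wm : w (-1) = b by exact: (wp (-1)).
have w0 : w 0 = a by exact: (wp 0).
have w1 : w 1 = 0%N by exact: (wp 1).
rewrite /marked w1 eqxx /= (_ : 1 - 2 = -1)// (_ : 1 - 1 = 0)//.
by rewrite wm w0 pat.
Qed.

(** Without context, 0 loses the weight that it has after the pattern [(b, a)].
*)
Lemma not_memory_suffices_nil : ~ memory_suffices X [::].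
Proof.
apply: (@not_memory_suffices _ [:: other_letter; a]) => //.
  by rewrite /prob_ending (_ : string_event _ _ _ = setT) ?probability_setT ?ltr01//;
    apply/seteqP; split.
have -> : prob_ending X 0 [::] = 1.
  by rewrite /prob_ending (_ : string_event _ _ _ = setT) ?probability_setT//;
    apply/seteqP; split.
rewrite mul1r /prob_ending /= -/(prob iid _).
pose C : set path_space := cylinder [:: 1] (fun=> 0%N).
have mC : measurable C by exact: measurable_cylinder.
have mp : measurable pat_then_0 by exact: measurable_cylinder.
have pC : pat_then_0 `<=` C.
  by move=> w wp i; rewrite inE => /eqP ->; exact: (wp 1).
apply: (@le_lt_trans _ _ (pr (C `\` pat_then_0))).
  apply: pr_le; [exact: measurable_string_event|exact: measurableD|].
  move=> w /(_ 0%N isT) /= w1'; have w1 : marked c w 1 = 0%N := w1'; split.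
    move=> i; rewrite inE => /eqP ->; move: w1; rewrite /marked.
    by case: ifP.
  by move=> /pat_then_0_off; rewrite w1.
rewrite pr_setD// {1}/C pr_cylinder// big_seq1 ltrBlDr ltrDl.
exact: pr_pat_then_0.
Qed.

(** After [a], 0 loses the weight that it has when [b] precedes [a]. *)
Lemma not_memory_suffices_letter : ~ memory_suffices X [:: a].
Proof.
have s_a := prob_ending_letter a1.
apply: (@not_memory_suffices _ [:: other_letter]) => //.
  by rewrite s_a geom_gt0.
rewrite s_a /prob_ending /= -/(prob iid _).
pose C : set path_space := cylinder [:: 0; 1] (fun i => if i == 0 then a else 0%N).
have mC : measurable C by exact: measurable_cylinder.
have mp : measurable pat_then_0 by exact: measurable_cylinder.
have pC : pat_then_0 `<=` C.
  move=> w wp i; rewrite !inE => /orP[] /eqP -> /=.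
    exact: (wp 0).
  exact: (wp 1).
apply: (@le_lt_trans _ _ (pr (C `\` pat_then_0))).
  apply: pr_le; [exact: measurable_string_event|exact: measurableD|].
  move=> w ws; have wa := ws 0%N isT; have w0 := ws 1%N isT.
  move: wa w0; rewrite /marked_process /= /marked_coord.
  rewrite (_ : 1 - 2 + 1 + 0 = 0)// (_ : 1 - 2 + 1 + 1 = 1)//.
  move=> /eqP; rewrite marked_eq// => /eqP wa w1; split.
    move=> i; rewrite !inE => /orP[] /eqP -> //=; move: w1; rewrite /marked.
    by case: ifP.
  by move=> /pat_then_0_off; rewrite w1.
rewrite pr_setD// {1}/C pr_cylinder// !big_cons big_nil mulr1 /= ltrBlDr ltrDl.
exact: pr_pat_then_0.
Qed.

Lemma markov_process : markov_of_order X 2.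
Proof.
by split; [exact: depends_on_last2_process|exact: not_depends_on_last].
Qed.

End WithPattern.
End Memory.

(** * Visits to a letter along the stopping times *)

Lemma ecvg_lt (R : realType) (f : nat -> \bar R) (l z : \bar R) :
  f n @[n --> \oo] --> l -> (l < z)%E ->
  exists n0, forall n, (n0 <= n)%N -> (f n < z)%E.
Proof.
move=> fl lz; have [n0 _ fn0] : \forall n \near \oo, (f n < z)%E.
  apply: (fl [set y | (y < z)%E]); apply: open_nbhs_nbhs.
  by split=> //; exact: open_ereal_lt_ereal.
by exists n0 => n n0n; exact: fn0.
Qed.

Lemma dist_two_ge1 (R : realType) (K : \bar R) :
  (K <= 1)%E -> (1 <= `|(2%:R)%:E - K|)%E.
Proof.
case: K => [r| |] //=.
rewrite !lee_fin => r1; rewrite ger0_norm; lra.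
Qed.

Lemma dist_one_ge1 (R : realType) (K : \bar R) :
  (2%:E <= K)%E -> (1 <= `|(1%:R)%:E - K|)%E.
Proof.
case: K => [r| |] //=; rewrite ?leey// !lee_fin => r1; rewrite ler0_norm; lra.
Qed.

(** Double counting: the sum is the integral over [A] of the number of sets [B
m] around a point. *)
Lemma sum_prob_count d (T : measurableType d) (R : realType)
    (P : probability T R) (N K : nat) (B : nat -> set T) (A : set T) :
  measurable A -> (forall m, measurable (B m)) ->
  (forall t, A t -> (\sum_(m < N) (t \in B m) <= K)%N) ->
  \sum_(m < N) prob P (A `&` B m) <= K%:R * prob P A.
Proof.
elim: N K A => [|N IH] K A mA mB AK.
  by rewrite big_ord0 mulr_ge0// pr_ge0.
pose A1 := A `&` B N; pose A0 := A `\` B N.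
have mA1 : measurable A1 by exact: measurableI.
have mA0 : measurable A0 by exact: measurableD.
have AE (C : set T) : measurable C ->
    prob P (A `&` C) = prob P (A1 `&` C) + prob P (A0 `&` C).
  move=> mC; rewrite -pr_setU; [|exact: measurableI..|].
    by rewrite -setIUl /A1 /A0 setDE -setIUr setUv setIT.
  by rewrite -subset0 => t [[[_ Bt] _] [[_]]].
have pA : prob P A = prob P A1 + prob P A0.
  by have := AE setT measurableT; rewrite !setIT.
have le0 : \sum_(m < N) prob P (A0 `&` B m) <= K%:R * prob P A0.
  apply: IH => // t [At Bt]; apply: leq_trans (AK t At).
  by rewrite big_ord_recr/= leq_addr.
rewrite big_ord_recr /= -/A1 (eq_bigr _ (fun (m : 'I_N) _ => AE (B m) (mB m))).
rewrite big_split/= pA mulrDr.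
suff : \sum_(m < N) prob P (A1 `&` B m) + prob P A1 <= K%:R * prob P A1 by lra.
have [t0|/existsNP[t /contrapT [At Bt]]] := pselect (forall t, ~ A1 t).
  have A1_0 : A1 = set0 by rewrite -subset0.
  rewrite A1_0 pr_set0 mulr0 addr0 big1// => m _.
  by rewrite set0I pr_set0.
have K0 : (0 < K)%N.
  apply: leq_trans (AK t At); rewrite big_ord_recr /= addn_gt0.
  by rewrite (mem_set Bt) orbT.
have KE : K%:R = K.-1%:R + 1 :> R by rewrite natr1 prednK.
rewrite KE mulrDl mul1r lerD2r; apply: IH => // t' [At' Bt'].
rewrite -ltnS prednK//; apply: leq_trans (AK t' At').
by rewrite big_ord_recr /= (mem_set Bt') addn1.
Qed.

Section StoppingTimes.
Variable lam : nat -> (nat -> nat) -> option nat.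
Hypothesis lam_inc : strictly_increasing lam.

Lemma stop_ge n x m : lam n x = Some m -> (n <= m)%N.
Proof.
elim: n m => [//|n IH] m /lam_inc[k /IH nk km].
exact: leq_ltn_trans nk km.
Qed.

Lemma stop_lt n n' x m' : (n < n')%N -> lam n' x = Some m' ->
  exists2 m, lam n x = Some m & (m < m')%N.
Proof.
elim: n' m' => [//|n' IH] m'; rewrite ltnS leq_eqVlt => /orP[/eqP <-|nn'].
  exact: lam_inc.
by move=> /lam_inc[k /(IH _ nn')[m lm mk] km']; exists m => //; exact: ltn_trans km'.
Qed.

(** The bound on [m] is [lam n / n <= 1 + 1 / D], freed of its denominators. *)
Definition tame (a D n1 : nat) (x : nat -> nat) : Prop :=
  forall n, (n1 <= n)%N ->
    exists m, [/\ lam n x = Some m, (D * m <= D.+1 * n)%N & x m != a].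

(** The times [lam n] with [n1 <= n < D * L] are distinct, lie before [D.+1 * L]
and are not visits to [a]; this leaves at most [L + n1] times for the visits. *)
Lemma tame_visits (a D n1 L : nat) (x : nat -> nat) : tame a D n1 x ->
  (\sum_(m < D.+1 * L) (x m == a) <= L + n1)%N.
Proof.
case: D => [|D] tx.
  rewrite mul1n (leq_trans _ (leq_addr _ _))//.
  apply: (@leq_trans (\sum_(m < L) 1)); last by rewrite sum1_card card_ord.
  by apply: leq_sum => m _; case: (_ == _).
set N := (D.+2 * L)%N.
pose mu n := if lam n x is Some m then m else 0%N.
have muP n : (n1 <= n)%N ->
    [/\ lam n x = Some (mu n), (D.+1 * mu n <= D.+2 * n)%N & x (mu n) != a].
  by move=> /tx[m [lm Dm xm]]; rewrite /mu lm.
have mu_lt n n' : (n1 <= n)%N -> (n < n')%N -> (mu n < mu n')%N.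
  move=> n1n nn'; have [ln' _ _] := muP n' (leq_trans n1n (ltnW nn')).
  by have [m lm] := stop_lt nn' ln'; rewrite /mu lm.
pose s := map mu (iota n1 (D.+1 * L - n1)).
have us : uniq s.
  rewrite map_inj_in_uniq ?iota_uniq// => n n'; rewrite !mem_iota.
  move=> /andP[n1n _] /andP[n1n' _] mm; apply/eqP; rewrite eqn_leq.
  by apply/andP; split; rewrite leqNgt; apply/negP => /mu_lt;
    rewrite mm ltnn => /(_ ltac:(assumption)).
have ss : {subset s <= [seq m <- iota 0 N | x m != a]}.
  move=> _ /mapP[n + ->]; rewrite mem_iota => /andP[n1n nL].
  have [_ Dm xm] := muP n n1n.
  rewrite mem_filter xm mem_iota /= add0n /N.
  have nDL : (n < D.+1 * L)%N by lia.
  nia.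
have := uniq_leq_size us ss; rewrite size_map size_iota size_filter.
have -> : (\sum_(m < N) (x m == a) = count (fun m => x m == a) (iota 0 N))%N.
  rewrite -sum1_count [RHS]big_mkcond.
  rewrite -(big_mkord xpredT (fun m => (x m == a) : nat)) /index_iota subn0.
  by apply: eq_bigr => m _; case: eqP.
have := count_predC (fun m => x m == a) (iota 0 N); rewrite size_iota.
have -> : count (predC (fun m => x m == a)) (iota 0 N) =
  count (fun m => x m != a) (iota 0 N) by apply: eq_count.
by rewrite /N; lia.
Qed.

End StoppingTimes.

(** * Partners chosen one after the other *)

Definition truncate (k : nat) (c : nat -> nat) : nat -> nat :=
  fun a => if (a < k)%N then c a else 0%N.

(** Dependent choice in which each value may depend on all earlier ones. *)
Lemma course_of_values_choice (Q : nat -> (nat -> nat) -> nat -> Prop) :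
  (forall k f, exists b, Q k f b) ->
  exists c, forall k, Q k (truncate k c) (c k).
Proof.
move=> exQ; have [g gQ] := choice (fun kf => exQ kf.1 kf.2).
pose s := fix s k := if k is k'.+1 then rcons (s k') (g (k', nth 0%N (s k')))
  else [::].
have size_s k : size (s k) = k by elim: k => //= k IH; rewrite size_rcons IH.
pose c k := nth 0%N (s k.+1) k.
have sE k : nth 0%N (s k) = truncate k c.
  apply/funext => a; rewrite /truncate; case: ltnP => [|ka]; last first.
    by rewrite nth_default// size_s.
  elim: k => // k IH; rewrite ltnS leq_eqVlt => /orP[/eqP -> //|ak].
  by rewrite /= nth_rcons size_s ak IH.
exists c => k.
have -> : c k = g (k, nth 0%N (s k)) by rewrite /c /= nth_rcons size_s ltnn eqxx.
by rewrite -sE; exact: (gQ (k, nth 0%N (s k))).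
Qed.

(** * Forcing a wrong answer *)

Section Estimator.
Variable R : realType.
Notation iid := (iid_measure R).
Notation pr := (prob iid).
Variables (lam : nat -> (nat -> nat) -> option nat) (h : nat -> seq nat -> nat).
Hypothesis lam_stop : forall n, is_stopping_time (lam n).
Hypothesis lam_inc : strictly_increasing lam.
Hypothesis h_values : forall (n : nat) (s : seq nat), h n s = 1%N \/ h n s = 2%N.

(** A marked letter looks two steps back, so the window opens at time [-2]. *)
Definition window (N : nat) : seq int := [seq i%:Z - 2 | i <- iota 0 N.+3].

Notation obs c w := (observed (marked_process R c) w).

Lemma mem_window (N : nat) (i : int) : (- 2 <= i <= N%:Z) -> i \in window N.
Proof.
move=> iN; apply/mapP; exists (absz (i + 2)); last by lia.
by rewrite mem_iota; lia.
Qed.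

Lemma obs_local c (N : nat) (w w' : path_space) :
  (forall i, i \in window N -> w i = w' i) ->
  forall i, (i <= N)%N -> obs c w i = obs c w' i.
Proof.
move=> ww' i iN; apply: marked_local; apply: ww'; apply: mem_window; lia.
Qed.

Lemma measurable_obs c (N : nat) (Q : (nat -> nat) -> Prop) :
  (forall x x', (forall i, (i <= N)%N -> x i = x' i) -> Q x -> Q x') ->
  measurable [set w : path_space | Q (obs c w)].
Proof.
move=> Qloc; apply: (@measurable_local (window N)) => w w' /obs_local ww' /=.
by apply: Qloc; exact: ww'.
Qed.

Lemma measurable_tame c a D n1 :
  measurable [set w : path_space | tame lam a D n1 (obs c w)].
Proof.
rewrite (_ : [set _ | _] = \bigcap_(n in [set n | (n1 <= n)%N]) \bigcup_m
    [set w : path_space | [/\ lam n (obs c w) = Some m,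
      (D * m <= D.+1 * n)%N & obs c w m != a]]); last first.
  apply/seteqP; split=> w /= tw n n1n.
    by have [m lm] := tw n n1n; exists m.
  by have [m _ lm] := tw n n1n; exists m.
apply: bigcap_measurableType => n _; apply: bigcupT_measurable => m.
apply: (@measurable_obs c m (fun x => [/\ lam n x = Some m,
  (D * m <= D.+1 * n)%N & x m != a])) => x x' xx' [lm Dm xm].
by split=> //; [exact: lam_stop xx' lm|rewrite -xx'].
Qed.

(** If the event had positive probability, mixing would make the average number
of visits before [D.+1 * L], on this event, at least about half of [D.+1 * L *
geom R a]. For the chosen [D] this is [2 * L], which for large [L] exceeds the
bound [L + n1] of [tame_visits]. *)
Lemma tame_null c a n1 : (1 < a)%N ->
  iid [set w | tame lam a (2 ^ a.+3).-1 n1 (obs c w)] = 0%E.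
Proof.
move=> a1; set D := (2 ^ a.+3).-1; set A := [set w | _].
have DS : D.+1 = (2 ^ a.+3)%N by rewrite prednK// expn_gt0.
have mA : measurable A by exact: measurable_tame.
rewrite (prE iid mA); congr EFin; apply/eqP; rewrite eq_le pr_ge0 andbT leNgt.
apply/negP => A0.
pose B m : set path_space := [set w | obs c w m = a].
have mB m : measurable (B m).
  apply: (@measurable_obs c m (fun x => x m = a)) => x x' xx' <-.
  by rewrite xx'.
have BE m : B m = translate m%:Z @^-1` [set w : path_space | w 0 = a].
  apply/seteqP; split=> w /=; rewrite /translate add0r.
    by move=> /eqP; rewrite marked_eq// => /eqP.
  by move=> wa; apply/eqP; rewrite marked_eq//; apply/eqP.
have ma : measurable [set w : path_space | w 0 = a] by exact: measurable_coordinate.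
have pa : pr [set w : path_space | w 0 = a] = geom R a by exact: pr_coordinate.
have g0 := geom_gt0 R a.
have [M0 _ mix] : \forall m \near \oo, pr A * geom R a / 2 <= pr (A `&` B m).
  have := mixing (R := R) mA ma; rewrite pa => /cvgr_ge mix.
  under eq_near do rewrite BE; apply: mix.
  by rewrite ltr_pdivrMr// ltr_pMr ?mulr_gt0// ltr1n.
pose L := (n1 + M0).+1; pose N := (D.+1 * L)%N.
have M0N : (M0 <= N)%N by rewrite /N; nia.
have upper : \sum_(m < N) pr (A `&` B m) <= (L + n1)%:R * pr A.
  apply: sum_prob_count => // w /(tame_visits lam_inc L); apply: leq_trans.
  apply: leq_sum => m _; case: (boolP (w \in B m)) => //.
  by rewrite inE => /eqP ->.
have lower : (N - M0)%:R * (pr A * geom R a / 2) <= \sum_(m < N) pr (A `&` B m).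
  rewrite -(big_mkord xpredT (fun m => pr (A `&` B m))) (big_cat_nat (leq0n M0) M0N)/=.
  rewrite -[leLHS]add0r; apply: lerD; first by apply: sumr_ge0 => m _; exact: pr_ge0.
  apply: (@le_trans _ _ (\sum_(M0 <= m < N) (pr A * geom R a / 2))).
    by rewrite sumr_const_nat mulr_natl.
  by apply: ler_sum_nat => m /andP[M0m _]; exact: mix.
have := le_trans lower upper; rewrite [leRHS]mulrC -!mulrA mulrCA.
rewrite (ler_pM2l A0) natrB// /N DS natrM mulrBl.
rewrite (_ : (2 ^ a.+3)%:R * L%:R * (geom R a / 2) = 2 * L%:R); last first.
  have : (2 ^ a.+1)%:R * geom R a = 1 by rewrite divff// pnatr_eq0 expn_eq0.
  rewrite [(2 ^ a.+3)%N]expnS [(2 ^ a.+2)%N]expnS !natrM => E.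
  have := congr1 ( *%R^~ L%:R) E; rewrite mul1r; lra.
have : M0%:R * (geom R a / 2) <= M0%:R.
  by rewrite ler_piMr//; have := geom_half R a; lra.
have LE : L%:R = n1%:R + M0%:R + 1 :> R by rewrite /L -natr1 natrD.
by rewrite natrD LE; lra.
Qed.

(** The answer 1 is given on the letter [k] at a stopping time between [k] and
[N]. The lower bound makes these answers occur later and later as [k] grows. *)
Definition wrong (k N : nat) (x : nat -> nat) : Prop :=
  exists n m, [/\ (k <= m <= N)%N, lam n x = Some m, x m = k &
    h n (mkseq x m.+1) = 1%N].

Lemma wrong_local k N x x' : (forall i, (i <= N)%N -> x i = x' i) ->
  wrong k N x -> wrong k N x'.
Proof.
move=> xx' [n [m [/andP[km mN] lm xm hm]]].
have xm' i : (i <= m)%N -> x i = x' i by move=> im; apply: xx'; exact: leq_trans mN.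
exists n, m; split; first by rewrite km.
- exact: lam_stop xm' lm.
- by rewrite -xm'.
- rewrite (_ : mkseq x' m.+1 = mkseq x m.+1)//; apply/eq_in_map => i.
  by rewrite mem_iota add0n => /andP[_ im]; rewrite xm'.
Qed.

Lemma measurable_wrong c k N : measurable [set w : path_space | wrong k N (obs c w)].
Proof. by apply: (@measurable_obs c N (wrong k N)) => x x'; exact: wrong_local. Qed.

Definition succeeds (c : nat -> nat) : Prop :=
  {ae iid, forall w, time_ratio R lam (obs c w) n @[n --> \oo] --> 1%E} /\
  {ae iid, forall w, estimation_error (marked_process R c) lam h w n @[n --> \oo] --> 0%E}.

Lemma eventually_small_error c (w : path_space) :
  estimation_error (marked_process R c) lam h w n @[n --> \oo] --> 0%E ->
  exists n0, forall n, (n0 <= n)%N -> exists2 m, lam n (obs c w) = Some m &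
    (`|(h n (mkseq (obs c w) m.+1))%:R%:E -
      memory_length (marked_process R c) (path_of (marked_process R c) w) m%:Z| < 1)%E.
Proof.
move=> /ecvg_lt /(_ lte01) [n0 err]; exists n0 => n /err.
rewrite /estimation_error; case: (lam n (obs c w)) => [m|]; last by [].
by exists m.
Qed.

(** If [k] has no partner, its memory length is at most one and the answer on
[k] must finally be 1. A path on which this answer is not given from time [k] on
has stopping times that avoid [k] from some point on, so it is tame. *)
Lemma trapped c k : (1 < k)%N -> (forall b, ~~ pattern c b k) -> succeeds c ->
  exists N, 3 / 4 < pr [set w | wrong k N (obs c w)].
Proof.
move=> k1 nopat [ratio err].
pose F N : set path_space := ~` [set w | wrong k N (obs c w)].
have mF N : measurable (F N) by apply: measurableC; exact: measurable_wrong.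
have niF : nonincreasing_seq F.
  move=> N N' NN'; apply/subsetPset; apply: subsetC => w /= [n [m [/andP[km mN] ? ? ?]]].
  by exists n, m; split=> //; rewrite km (leq_trans mN).
have F0 : pr (\bigcap_N F N) = 0.
  rewrite /prob (measure_negligible (bigcapT_measurable mF))//.
  set D := (2 ^ k.+3).-1.
  have D0 : (0 < D)%N by rewrite /D -ltnS prednK ?expn_gt0// (leq_exp2l 1).
  have tnull : iid.-negligible (\bigcup_n1 [set w | tame lam k D n1 (obs c w)]).
    apply: negligible_bigcup => n1; apply/negligibleP; first exact: measurable_tame.
    exact: tame_null.
  apply: negligibleS (negligibleU (negligibleU ratio err) tnull) => w Fw.
  apply: contrapT => /not_orP[/not_orP[/contrapT rw /contrapT ew]] /= []; move: rw ew => /=.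
  move=> /(@ecvg_lt _ _ _ (1 + D%:R^-1)%:E).
  rewrite lte_fin ltrDl invr_gt0 ltr0n D0 => /(_ isT) [n1 rat].
  move=> /eventually_small_error [n2 err1].
  exists (maxn (maxn n1 n2) (maxn k 1)) => // n; rewrite !geq_max => /andP[/andP[n1n n2n]].
  move=> /andP[kn n0]; have [m lm em] := err1 n n2n; exists m; split=> //.
    have := rat n n1n; rewrite /time_ratio lm lte_fin ltr_pdivrMr ?ltr0n//.
    rewrite mulrDl mul1r => /ltW; rewrite -(ler_pM2l (_ : 0 < D%:R :> R)) ?ltr0n//.
    rewrite mulrDr mulrA divff ?mul1r ?pnatr_eq0 -?lt0n//.
    by rewrite -!natrM -natrD ler_nat mulSn addnC.
  apply/negP => /eqP xm.
  have km : (k <= m)%N by apply: leq_trans kn (stop_ge lam_inc lm).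
  have K1 : (memory_length (marked_process R c) (path_of (marked_process R c) w) m%:Z <= 1)%E.
    apply: memory_length_le1; rewrite (_ : path_of _ w m%:Z = k)//.
    exact: memory_suffices_letter.
  have [hm|hm] := h_values n (mkseq (obs c w) m.+1).
    by apply: (Fw m I); exists n, m; rewrite km leqnn.
  by move: em; rewrite hm ltNge dist_two_ge1.
have [N FN] : exists N, pr (F N) < 1 / 4.
  by apply: pr_bigcap_lt => //; rewrite F0; lra.
exists N; move: FN; rewrite pr_setC; last exact: measurable_wrong.
by move=> ?; lra.
Qed.

Definition large_letter (N b : nat) : set path_space :=
  [set w | exists2 i, i \in window N & (b <= w i)%N].

Lemma measurable_large_letter N b : measurable (large_letter N b).
Proof.
apply: (@measurable_local (window N)) => w w' ww' [i iN bw].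
by exists i => //; rewrite -ww'.
Qed.

(** These events decrease to the empty set as [b] grows. *)
Lemma large_letter_rare N (e : R) : 0 < e -> exists b0, forall b, (b0 <= b)%N ->
  pr (large_letter N b) < e.
Proof.
move=> e0; have mono b b' : (b <= b')%N -> large_letter N b' `<=` large_letter N b.
  by move=> bb' w [i iN b'w]; exists i => //; exact: leq_trans b'w.
have [b0 lt_e] : exists b, pr (large_letter N b) < e.
  apply: pr_bigcap_lt.
  - by move=> b; exact: measurable_large_letter.
  - by move=> b b' bb'; apply/subsetPset; exact: mono.
  - rewrite (_ : \bigcap_b _ = set0) ?pr_set0// -subset0 => w lw.
    have [b wb] : exists b, forall i, i \in window N -> (w i < b)%N.
      elim: (window N) => [|i s [b wb]]; first by exists 0%N.
      exists (maxn b (w i).+1) => j; rewrite inE => /orP[/eqP ->|/wb]; lia.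
    by have [i iN] := lw b I; rewrite leqNgt wb.
exists b0 => b b0b; apply: le_lt_trans lt_e.
by apply: pr_le; [exact: measurable_large_letter..|exact: mono].
Qed.

(** A pattern that is lost by truncation involves a letter of size at least [c
k]. *)
Lemma obs_truncate (c : nat -> nat) (k N : nat) (w : path_space) :
  (forall a, (k <= a)%N -> (c k <= c a)%N) ->
  ~ large_letter N (c k) w ->
  forall i, (i <= N)%N -> obs (truncate k c) w i = obs c w i.
Proof.
move=> ck small i iN.
rewrite /observed /marked_process /= /marked_coord /marked.
suff -> : pattern (truncate k c) (w (i%:Z - 2)) (w (i%:Z - 1)) =
          pattern c (w (i%:Z - 2)) (w (i%:Z - 1)) by [].
have uk : (w (i%:Z - 2)%R < c k)%N.
  rewrite ltnNge; apply/negP => cw; apply: small; exists (i%:Z - 2) => //.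
  by apply: mem_window; lia.
rewrite /pattern /truncate; have [u1 /=|//] := boolP (1 < w (i%:Z - 2)%R)%N.
case: (ltnP (w (i%:Z - 1)) k) => // /ck cka.
by congr (_ && _); apply/idP/idP => /eqP; lia.
Qed.

(** When the partner of [k] is chosen, the letters from [k] on have none, so
that [trapped] applies; the new partner is then taken rare in the period found.
The letter 2, its own partner, keeps the order of all chains equal to two. *)
Lemma diagonal_partners :
  (forall c a b, pattern c b a -> succeeds c) -> exists c : nat -> nat,
  [/\ forall k, (1 < k)%N -> pattern c (c k) k,
      forall k a, (1 < k)%N -> (k <= a)%N -> (c k <= c a)%N
    & forall k, (2 < k)%N ->
        exists2 N, 3 / 4 < pr [set w | wrong k N (obs (truncate k c) w)] &
          pr (large_letter N (c k)) < 1 / 4].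
Proof.
move=> all_succeed.
(* Given the partners [f] of the letters below [k], the value [b] is suitable as
   the partner of [k]; the conditions on [f] hold for the truncations of a [c]
   with [c 2 = 2]. *)
pose Q k (f : nat -> nat) b := (k = 2 -> b = 2)%N /\
  ((2 < k)%N -> f 2%N = 2%N -> f k = 0%N -> (f k.-1 <= b)%N /\
    exists2 N, 3 / 4 < pr [set w | wrong k N (obs f w)] &
      pr (large_letter N b) < 1 / 4).
have [c cQ] : exists c, forall k, Q k (truncate k c) (c k).
  apply: course_of_values_choice => k f; rewrite /Q.
  have [-> |k2] := eqVneq k 2%N; first by exists 2%N.
  have [kgt|] := ltnP 2 k; last by exists 0%N; split=> // k_2; rewrite k_2 in k2.
  have [[f2 fk]|nf] := pselect (f 2%N = 2%N /\ f k = 0%N); last first.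
    exists 0%N; split=> [k_2|_ f2 fk]; first by rewrite k_2 in k2.
    by exfalso; apply: nf.
  have [N wN] : exists N, 3 / 4 < pr [set w | wrong k N (obs f w)].
    apply: trapped; first by lia.
      by move=> [|b]; rewrite /pattern fk ?andbF.
    by apply: (@all_succeed f 2%N 2%N); rewrite /pattern f2.
  have [b0 rare] := @large_letter_rare N (1 / 4) ltac:(lra).
  exists (maxn b0 (f k.-1)); split=> [k_2|_ _ _]; first by rewrite k_2 in k2.
  by split; [rewrite leq_maxr|exists N => //; apply: rare; rewrite leq_maxl].
have c2 : c 2%N = 2%N by have [+ _] := cQ 2%N; apply.
have step k : (2 < k)%N -> (c k.-1 <= c k)%N /\
    exists2 N, 3 / 4 < pr [set w | wrong k N (obs (truncate k c) w)] &
      pr (large_letter N (c k)) < 1 / 4.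
  move=> k2; have [_ /(_ k2)] := cQ k; rewrite /truncate k2 c2 ltnn => /(_ erefl erefl).
  by rewrite prednK ?leqnn//; lia.
have mono k a : (2 <= k)%N -> (k <= a)%N -> (c k <= c a)%N.
  move=> k2; elim: a => [|a IH]; first by rewrite leqn0 => /eqP ->.
  rewrite leq_eqVlt => /orP[/eqP -> //|ka]; apply: leq_trans (IH ka) _.
  by apply: (step a.+1 _).1; lia.
have pat k : (2 <= k)%N -> pattern c (c k) k.
  by move=> k2; rewrite /pattern eqxx andbT k2 andbT -{1}c2 mono.
exists c; split=> // k k2; exact: (step k k2).2.
Qed.

(** The truncated chain and the full one show the same letters up to time [N]
unless a letter of size at least [c k] is met. *)
Lemma wrong_after_choice (c : nat -> nat) (k N : nat) :
  (forall a, (k <= a)%N -> (c k <= c a)%N) ->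
  3 / 4 < pr [set w | wrong k N (obs (truncate k c) w)] ->
  pr (large_letter N (c k)) < 1 / 4 ->
  1 / 2 <= pr [set w | wrong k N (obs c w)].
Proof.
move=> mono wN rare.
have : pr [set w | wrong k N (obs (truncate k c) w)] <=
    pr ([set w | wrong k N (obs c w)] `|` large_letter N (c k)).
  apply: pr_le; [exact: measurable_wrong| |].
    by apply: measurableU; [exact: measurable_wrong|exact: measurable_large_letter].
  move=> w ww; have [lw|nlw] := pselect (large_letter N (c k) w); [by right|left].
  apply: (wrong_local _ ww).
  exact: obs_truncate.
move=> /le_trans /(_ (pr_setU_le _ _ _)).
move=> /(_ (measurable_wrong c k N) (measurable_large_letter N (c k))).
lra.
Qed.

(** For each [k >= 3] the answer 1 is given on the letter [k], at time [k] or
later, with probability at least 1/2; so with probability at least 1/2 this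
happens for infinitely many [k]. But each [k] has memory length at least two. *)
Lemma not_all_succeed : ~ (forall c a b, pattern c b a -> succeeds c).
Proof.
move=> all_succeed; have [c [pat mono step]] := diagonal_partners all_succeed.
have wrong_half k : (2 < k)%N ->
    exists N, 1 / 2 <= pr [set w | wrong k N (obs c w)].
  move=> k2; have [N wN rare] := step k k2; exists N.
  apply: wrong_after_choice wN rare => a; apply: mono; exact: ltnW.
have [N NP] : exists N : nat -> nat, forall k, (2 < k)%N ->
    1 / 2 <= pr [set w | wrong k (N k) (obs c w)].
  suff /choice[N NP] : forall k, exists N, (2 < k)%N ->
      1 / 2 <= pr [set w | wrong k N (obs c w)] by exists N.
  by move=> k; have [/wrong_half[N wN]|k2] := ltnP 2 k; [exists N|exists 0%N].
pose W k : set path_space := [set w | wrong k (N k) (obs c w)].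
pose U j := \bigcup_(k in [set k | (maxn 3 j <= k)%N]) W k.
have mU j : measurable (U j).
  by apply: bigcup_measurable => k _; exact: measurable_wrong.
have niU : nonincreasing_seq U.
  move=> j j' jj'; apply/subsetPset => w [k /= jk Wk]; exists k => //=; lia.
have Uhalf j : 1 / 2 <= pr (U j).
  apply: le_trans (NP (maxn 3 j) _) _; first by lia.
  apply: pr_le => //; first exact: measurable_wrong.
  by move=> w Ww; exists (maxn 3 j) => /=.
have limU : pr (\bigcap_j U j) = 0.
  have [_ err] := all_succeed _ _ _ (pat 2%N isT).
  rewrite /prob (measure_negligible (bigcapT_measurable mU))//.
  apply: negligibleS err => w Uw /= /eventually_small_error [n0 small].
  have [m0 lm0 _] := small n0 (leqnn _).
  have [k /= jk [n [m [/andP[km _] lm xm hm]]]] := Uw m0.+1 I.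
  (* [lam n] has the value [m >= k > m0 = lam n0]. *)
  have n0n : (n0 <= n)%N.
    rewrite leqNgt; apply/negP => /(stop_lt lam_inc) /(_ lm0) [m'].
    by rewrite lm => -[<-]; lia.
  have [m'] := small n n0n; rewrite lm => -[<-]; rewrite hm ltNge => /negP; apply.
  apply: dist_one_ge1; apply: memory_length_ge2.
    exact: (not_memory_suffices_nil (pat 2%N isT)).
  rewrite (_ : path_of _ w m%:Z = k)//.
  by apply: (@not_memory_suffices_letter R c k (c k)); apply: pat; lia.
have [j] : exists j, pr (U j) < 1 / 2.
  by apply: pr_bigcap_lt => //; rewrite limU; lra.
by rewrite ltNge Uhalf.
Qed.

End Estimator.

Theorem theorem6 (R : realType) :
  ~ exists (lam : nat -> (nat -> nat) -> option nat) (h : nat -> seq nat -> nat),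
      [/\ forall n : nat, is_stopping_time (lam n),
          strictly_increasing lam,
          forall (n : nat) (s : seq nat), h n s = 1%N \/ h n s = 2%N
        & forall (d : measure_display) (T : measurableType d)
                 (P : probability T R) (X : int -> {RV P >-> nat}),
            stationary X -> ergodic X -> markov_of_order X 2 ->
            {ae P, forall t : T,
              time_ratio R lam (observed X t) n @[n --> \oo] --> 1%E}
            /\
            {ae P, forall t : T,
              estimation_error X lam h t n @[n --> \oo] --> 0%E}].
Proof.
move=> [lam [h [lam_stop lam_inc h_values univ]]].
apply: (@not_all_succeed R lam h lam_stop lam_inc h_values) => c a b pat.
apply: univ; [exact: stationary_process|exact: ergodic_process|].
exact: markov_process pat.
Qed.
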